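(* Let $k$ be a field of characteristic $0$ and let $A=A_0\oplus A_1$ be a $\mathbb{Z}/2\mathbb{Z}$-graded associative $k$-algebra with $\dim_k A_0=r<\infty$, equipped with an odd invariant non-degenerate scalar product $\langle\cdot,\cdot\rangle:A_0\otimes A_1\to k$. Assume that the Lie algebra $A_0$ is unimodular, i.e. $\operatorname{tr}([a,\cdot]|_{A_0})=0$ for all $a\in A_0$. Let $N\ge 1$ and let $\lambda$ be a constant. Then the product of the closed de Rham differential form $$\Psi(X)=\exp\Big(\tfrac{1}{3!}\sum_{\alpha,\beta,\gamma}(m_A)_{\alpha\beta\gamma}\operatorname{Tr}(X^\alpha X^\beta X^\gamma)+\tfrac12\sum_{\alpha,\beta,\gamma}(m_A)_\alpha^{\beta\gamma}\operatorname{Tr}\big(X^\alpha\tfrac{\partial}{\partial X^\beta}\wedge\tfrac{\partial}{\partial X^\gamma}\big)\Big)\vdash\lambda\prod_{\alpha,i,j}dX_i^{\alpha,j}$$ on $\Pi A_1\otimes gl_N$ with the function $\exp\operatorname{Tr}\langle Y,X\rangle$, where $Y\in A_0\otimes gl_N$ and $X\in\Pi A_1\otimes gl_N$, is an $A_0\otimes gl_N$-equivariantly closed differential form: $$d_{A_0\otimes gl_N}\big(\exp(\operatorname{Tr}\langle Y,X\rangle)\,\Psi(X)\big)=0,$$ where the equivariant differential is $$d_{A_0\otimes gl_N}\Phi(Y)=d_{DR}\Phi-\sum_{\alpha,l,j}Y_{\alpha,j}^l\,\big(i_{[E_l^j\otimes e^\alpha,\cdot]}\Phi\big).$$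
   Context: Parity: $\Pi A$ denotes the parity-inverted vector space, $(\Pi A)_0=A_1$, $(\Pi A)_1=A_0$, and $\pi a\in\Pi A$ is the element $a$ with reversed parity; in particular $\Pi A_1$ is an even vector space. The scalar product is symmetric and, being odd, pairs $A_0$ with $A_1$ only. Multiplication tensor: $m_A(\pi a_1,\pi a_2,\pi a_3)=(-1)^{\bar a_2+1}\langle a_1a_2,a_3\rangle$ for homogeneous $a_1,a_2,a_3\in A$; it is a cyclically invariant linear function on $(\Pi A)^{\otimes 3}$. Fix a dual pair of bases $\{e^\alpha\}$ of $A_0$ and $\{\xi_\alpha\}$ of $A_1$. Then $(m_A)_{\alpha\beta\gamma}=m_A(\pi\xi_\alpha,\pi\xi_\beta,\pi\xi_\gamma)$ and $(m_A)_\alpha^{\beta\gamma}=m_A(\pi\xi_\alpha,\pi e^\beta,\pi e^\gamma)$ are the components of this tensor. Coordinates: a point of the affine space $\Pi A_1\otimes gl_N$ is $X=\sum_\alpha\pi\xi_\alpha\otimes X^\alpha$, where $X^\alpha\in gl_N$ has entries $X_i^{\alpha,j}=(X^\alpha)_i^j$, $1\le i,j\le N$. The symbol $\frac{\partial}{\partial X^\beta}$ denotes the matrix of vector fields whose $({}^i_j)$ entry is $\frac{\partial}{\partial (X^\beta)_i^j}$; inside the trace, matrices are multiplied in the written order and vector fields are multiplied by $\wedge$. A point of $A_0\otimes gl_N$ is $Y=\sum_{\alpha,l,j}Y_{\alpha,j}^l\,E_l^j\otimes e^\alpha$, where the $E_l^j$ are the elementary matrices. $\operatorname{Tr}\langle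 Y,X\rangle$ is the pairing of $A_0\otimes gl_N$ with $\Pi A_1\otimes gl_N$ given by the scalar product on $A$ and the trace of the matrix product. Contraction: $\gamma\vdash\omega$ denotes the contraction of a polyvector field $\gamma$ with a differential form $\omega$, a function acting by multiplication and a vector field by interior product; the exponential of the sum of the cubic function and the bivector field is taken in the algebra of polyvector fields. $\prod_{\alpha,i,j}dX_i^{\alpha,j}$ is the constant top-degree form on $\Pi A_1\otimes gl_N$. Equivariant forms: the Lie algebra $A_0\otimes gl_N$ (with the commutator bracket) acts on $\Pi A_1\otimes gl_N$ by $X\mapsto[Y,X]$ (the co-adjoint action) and on itself by the adjoint action. Equivariant forms are the elements of $$\Omega^{A_0\otimes gl_N}_{\Pi A_1\otimes gl_N}=\big(\Omega_{\Pi A_1\otimes gl_N}\otimes\mathcal{O}_{A_0\otimes gl_N}\big)^{A_0\otimes gl_N},$$ that is, invariant differential forms in $X$ depending on the parameter $Y$ (exponentials being allowed as coefficients). In the equivariant differential, $d_{DR}$ is the de Rham differential in $X$, and $i_{[E_l^j\otimes e^\alpha,\cdot]}$ is the operator of contraction with the linear vector field on $\Pi A_1\otimes gl_N$ whose value at $X$ is $[E_l^j\otimes e^\alpha,X]$.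
   Formalization: The bivector term in Ψ is taken with coefficient 1 instead of 1/2; with 1/2 the equivariant closedness fails (e.g. A_0=ke, A_1=kξ, e²=e, eξ=ξe=ξ, ξ²=0, N=2, λ=1). Functions of X, Y are formal power series over k. *)

(* Defs.v *)
From HB Require Import structures.
From mathcomp Require Import all_boot all_order all_algebra.
From mathcomp Require Import boolp.
From mathcomp.multinomials Require Import mpoly.

Set Implicit Arguments.
Unset Strict Implicit.
Unset Printing Implicit Defensive.

Import GRing.Theory.

Local Open Scope ring_scope.

(* Formal power series over R whose variables are the elements of V; a       *)
(* monomial is a multi-index on 'I_#|V|, the variable v having the number    *)
(* enum_rank v.                                                              *)
Definition fps (V : finType) (R : comNzRingType) : Type := 'X_{1..#|V|} -> R.

Section FpsRing.
Variables (V : finType) (R : comNzRingType).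
Implicit Types f g h : fps V R.

HB.instance Definition _ := gen_eqMixin (fps V R).
HB.instance Definition _ := gen_choiceMixin (fps V R).

Definition fps0 : fps V R := fun=> 0.
Definition fps_opp f : fps V R := fun m => - f m.
Definition fps_add f g : fps V R := fun m => f m + g m.

Fact fps_addA : associative fps_add.
Proof. by move=> f g h; apply: funext => m; apply: addrA. Qed.
Fact fps_addC : commutative fps_add.
Proof. by move=> f g; apply: funext => m; apply: addrC. Qed.
Fact fps_add0 : left_id fps0 fps_add.
Proof. by move=> f; apply: funext => m; apply: add0r. Qed.
Fact fps_addN : left_inverse fps0 fps_opp fps_add.
Proof. by move=> f; apply: funext => m; apply: addNr. Qed.

HB.instance Definition _ :=
  GRing.isZmodule.Build (fps V R) fps_addA fps_addC fps_add0 fps_addN.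

Definition fpsC (c : R) : fps V R := fun m => if m == 0%MM then c else 0.

Definition fps_mul f g : fps V R := fun m =>
  \sum_(p : 'X_{1..#|V| < (mdeg m).+1, (mdeg m).+1} | m == (p.1 + p.2)%MM)
     f p.1 * g p.2.

Definition fps_trunc d f : {mpoly R[#|V|]} :=
  \sum_(m : 'X_{1..#|V| < d}) f m *: 'X_[m].

Lemma fps_truncE d f m : (mdeg m < d)%N -> (fps_trunc d f)@_m = f m.
Proof. by move=> lt_md; rewrite mcoeff_mpoly. Qed.

Lemma fps_mulE f g m (p q : {mpoly R[#|V|]}) :
    (forall m', (mdeg m' <= mdeg m)%N -> p@_m' = f m') ->
    (forall m', (mdeg m' <= mdeg m)%N -> q@_m' = g m') ->
  fps_mul f g m = (p * q)@_m.
Proof.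
move=> hp hq; rewrite mcoeffM; apply: eq_bigr => -[[m1 h1] [m2 h2]] _ /=.
by rewrite hp ?hq.
Qed.

Lemma fps_mul_trunc f g m d : (mdeg m < d)%N ->
  fps_mul f g m = (fps_trunc d f * fps_trunc d g)@_m.
Proof.
move=> lt_md; apply: fps_mulE => m' le_m'm;
  by rewrite fps_truncE // (leq_ltn_trans le_m'm).
Qed.

Fact fps_mulA : associative fps_mul.
Proof.
move=> f g h; apply: funext => m; pose d := (mdeg m).+1.
have T f' m' : (mdeg m' <= mdeg m)%N -> (fps_trunc d f')@_m' = f' m'.
  by move=> le_m'; rewrite fps_truncE.
rewrite (@fps_mulE _ _ _ (fps_trunc d f) (fps_trunc d g * fps_trunc d h)).
- rewrite mulrA; apply/esym/fps_mulE; last exact: T.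
  by move=> m' le_m'; rewrite (@fps_mul_trunc _ _ _ d).
- exact: T.
- by move=> m' le_m'; rewrite (@fps_mul_trunc _ _ _ d).
Qed.

Fact fps_mulC : commutative fps_mul.
Proof.
move=> f g; apply: funext => m.
by rewrite !(@fps_mul_trunc _ _ _ (mdeg m).+1) // mulrC.
Qed.

Fact fps_mul1 : left_id (fpsC 1) fps_mul.
Proof.
move=> f; apply: funext => m.
rewrite (@fps_mulE _ _ _ 1 (fps_trunc (mdeg m).+1 f)) => [|m' _|m' le_m'].
- by rewrite mul1r fps_truncE.
- by rewrite mcoeff1 /fpsC; case: eqP.
- by rewrite fps_truncE.
Qed.

Fact fps_mulDl : left_distributive fps_mul fps_add.
Proof.
move=> f g h; apply: funext => m; rewrite /fps_add /fps_mul -big_split /=.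
by apply: eq_bigr => p _; rewrite mulrDl.
Qed.

Fact fps_oner_neq0 : fpsC 1 != 0.
Proof.
apply/eqP => /(congr1 (fun f : fps V R => f 0%MM)); rewrite /fpsC eqxx.
by apply/eqP/oner_neq0.
Qed.

HB.instance Definition _ := GRing.Zmodule_isComNzRing.Build (fps V R)
  fps_mulA fps_mulC fps_mul1 fps_mulDl fps_oner_neq0.

Definition fpsX (v : V) : fps V R := fun m => (m == U_(enum_rank v)%MM)%:R.

Definition fps_deriv (v : V) f : fps V R :=
  fun m => f (m + U_(enum_rank v))%MM *+ (m (enum_rank v)).+1.

End FpsRing.

Arguments fpsC {V R} c.
Arguments fpsX {V R} v.

(* The exterior algebra over R on generators indexed by V. Its elements are  *)
(* the families of coefficients w J of the monomials v_1 /\ ... /\ v_p, where *)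
(* J = {v_1 < ... < v_p} in the order of enum V. It models both forms        *)
(* (generators dX_v) and polyvector fields (generators d/dX_v).              *)
Definition ext (V : finType) (R : comNzRingType) : Type := {ffun {set V} -> R}.

Section ExtRing.
Variables (V : finType) (R : comNzRingType).
Implicit Types (J K L M : {set V}) (u w z : ext V R).

HB.instance Definition _ := GRing.Zmodule.on (ext V R).

Definition ext_inv K L : nat :=
  (\sum_(a in K) \sum_(b in L) (enum_rank b < enum_rank a))%N.

Definition extC (c : R) : ext V R := [ffun J : {set V} => if J == set0 then c else 0].
Definition extX (v : V) : ext V R := [ffun J : {set V} => (J == [set v])%:R].

Definition ext_mul u w : ext V R :=
  [ffun J : {set V} => \sum_(K : {set V} | K \subset J)
               (-1) ^+ ext_inv K (J :\: K) * u K * w (J :\: K)].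

Lemma ext_inv0l L : ext_inv set0 L = 0%N.
Proof. by rewrite /ext_inv big_set0. Qed.

Lemma ext_inv0r K : ext_inv K set0 = 0%N.
Proof. by rewrite /ext_inv big1 // => a _; rewrite big_set0. Qed.

Lemma big_disjU (A B : {set V}) (F : V -> nat) : [disjoint A & B] ->
  (\sum_(a in A :|: B) F a = \sum_(a in A) F a + \sum_(a in B) F a)%N.
Proof. by move=> dAB; rewrite -bigU //=; apply: eq_bigl => a; rewrite !inE. Qed.

Lemma ext_invUl K L M : [disjoint K & L] ->
  ext_inv (K :|: L) M = (ext_inv K M + ext_inv L M)%N.
Proof. by move=> dKL; rewrite /ext_inv big_disjU. Qed.

Lemma ext_invUr K L M : [disjoint L & M] ->
  ext_inv K (L :|: M) = (ext_inv K L + ext_inv K M)%N.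
Proof.
move=> dLM; rewrite /ext_inv -big_split /=; apply: eq_bigr => a _.
by rewrite big_disjU.
Qed.

Fact ext_mulA : associative ext_mul.
Proof.
move=> u w z; apply/ffunP => J; rewrite !ffunE.
transitivity (\sum_(L : {set V} | L \subset J)
  \sum_(M : {set V} | M \subset J :\: L)
    (-1) ^+ (ext_inv L (J :\: L) + ext_inv M (J :\: (L :|: M)))
      * u L * w M * z (J :\: (L :|: M))).
  apply: eq_bigr => L sLJ; rewrite ffunE mulr_sumr; apply: eq_bigr => M sM.
  by rewrite setDDl exprD !mulrA; congr (_ * _ * _); rewrite mulrAC.
transitivity (\sum_(K : {set V} | K \subset J) \sum_(L : {set V} | L \subset K)
  (-1) ^+ (ext_inv K (J :\: K) + ext_inv L (K :\: L))
      * u L * w (K :\: L) * z (J :\: K)); last first.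
  apply: eq_bigr => K sKJ; rewrite ffunE mulr_sumr mulr_suml.
  by apply: eq_bigr => L sL; rewrite exprD !mulrA.
rewrite [RHS](exchange_big_dep (fun L : {set V} => L \subset J)) /=; last first.
  by move=> K L sKJ sLK; exact: subset_trans sLK sKJ.
apply: eq_bigr => L sLJ.
rewrite [RHS](reindex_onto (fun M => L :|: M) (fun K => K :\: L)) /=; last first.
  by move=> K /andP[_ sLK]; rewrite setDE setUIr setUCr setIT; apply/setUidPr.
apply: eq_big => [M | M sM].
  rewrite subUset sLJ subsetUl andbT /= setDUl setDv set0U subsetD.
  by congr (_ && _); rewrite -setI_eq0 setIC; apply/eqP/eqP => [dLM|<-];
    [apply/setDidPl; rewrite -setI_eq0 setIC dLM
    | rewrite setIC setIDAC -setIDA setDv setI0].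
move: (sM); rewrite subsetD => /andP[sMJ dML].
have dLM : [disjoint L & M] by rewrite disjoint_sym.
have -> : (L :|: M) :\: L = M by rewrite setDUl setDv set0U; apply/setDidPl.
congr (_ * _ * _ * _); congr (_ ^+ _).
have -> : J :\: L = M :|: (J :\: (L :|: M)).
  rewrite -setDDl; apply/setP => x; rewrite !inE.
  case xM: (x \in M) => //=; have:= subsetP sM x xM; by rewrite !inE.
rewrite ext_invUr; last by rewrite -setDDl -setI_eq0 setDE setICA setICr setI0.
rewrite (ext_invUl _ dLM); set x := ext_inv L _; set y := ext_inv L _.
by rewrite -addnA [RHS]addnC.
Qed.

Fact ext_mul1 : left_id (extC 1) ext_mul.
Proof.
move=> w; apply/ffunP => J; rewrite ffunE (bigD1 set0) ?sub0set //= big1.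
  by rewrite ffunE eqxx ext_inv0l setD0 !mul1r addr0.
by move=> K /andP[_ /negPf nK0]; rewrite ffunE nK0 mulr0 mul0r.
Qed.

Fact ext_mulr1 : right_id (extC 1) ext_mul.
Proof.
move=> w; apply/ffunP => J; rewrite ffunE (bigD1 J) //= big1.
  by rewrite ffunE setDv eqxx ext_inv0r mul1r mulr1 addr0.
move=> K /andP[sKJ nKJ]; rewrite ffunE setD_eq0; case: ifP => [sJK|_].
  by rewrite eqEsubset sKJ sJK in nKJ.
by rewrite mulr0.
Qed.

Fact ext_mulDl : left_distributive ext_mul +%R.
Proof.
move=> u w z; apply/ffunP => J; rewrite !ffunE -big_split /=.
by apply: eq_bigr => K _; rewrite ffunE mulrDr mulrDl.
Qed.

Fact ext_mulDr : right_distributive ext_mul +%R.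
Proof.
move=> u w z; apply/ffunP => J; rewrite !ffunE -big_split /=.
by apply: eq_bigr => K _; rewrite ffunE mulrDr.
Qed.

Fact ext_oner_neq0 : extC 1 != 0.
Proof.
apply/eqP => /ffunP/(_ set0); rewrite !ffunE eqxx.
by apply/eqP/oner_neq0.
Qed.

HB.instance Definition _ := GRing.Zmodule_isNzRing.Build (ext V R)
  ext_mulA ext_mul1 ext_mulr1 ext_mulDl ext_mulDr ext_oner_neq0.

Definition ext_map (F : R -> R) w : ext V R := [ffun J : {set V} => F (w J)].

Definition ext_top : ext V R := [ffun J : {set V} => (J == [set: V])%:R].

(* Interior product with the vector field d/dX_v. *)
Definition iprod (v : V) w : ext V R :=
  [ffun J : {set V} => if v \in J then 0 else (-1) ^+ ext_inv [set v] J * w (v |: J)].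

(* The action of the algebra of polyvector fields on forms: a function       *)
(* multiplies, and v_1 /\ ... /\ v_p acts by i_{v_1} o ... o i_{v_p}.        *)
Definition contract (g w : ext V R) : ext V R :=
  \sum_(J : {set V}) extC (g J) * foldr iprod w (enum J).

End ExtRing.

Arguments extC {V R} c.
Arguments extX {V R} v.
Arguments ext_top {V R}.

(* Exponentials. These are the sums of the exponential series, in the formal *)
(* topology, only for arguments without constant term (coefficientwise, for  *)
(* ext): then the n-th power has no term of degree < n in the variables, so  *)
(* the coefficient of m involves only the powers n <= mdeg m.                *)
Definition fps_exp (V : finType) (k : fieldType) (f : fps V k) : fps V k :=
  fun m => \sum_(n < (mdeg m).+1) (n`!%:R)^-1 * (f ^+ n) m.

Definition ext_exp (V W : finType) (k : fieldType) (g : ext V (fps W k)) :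
    ext V (fps W k) :=
  [ffun J : {set V} => fun m => \sum_(n < (mdeg m).+1) (n`!%:R)^-1 * (g ^+ n) J m].

(* A Z/2-graded associative algebra A0 + A1, not necessarily unital, with an *)
(* odd invariant nondegenerate scalar product; a graded vector space is the  *)
(* pair of its homogeneous parts, true being the odd parity.                 *)
Definition homogeneous (A0 A1 : nmodType) (p : bool) (a : A0 * A1) : Prop :=
  if p then a.1 = 0 else a.2 = 0.

Record oddAlgebra (k : fieldType) := OddAlgebra {
  even_part : vectType k;
  odd_part : lmodType k;
  amul : even_part * odd_part -> even_part * odd_part -> even_part * odd_part;
  aform : even_part * odd_part -> even_part * odd_part -> k;
  amul_linearl : forall b, linear (amul ^~ b);
  amul_linearr : forall a, linear (amul a);
  amulA : associative amul;
  amul_graded : forall p q a b, homogeneous p a -> homogeneous q b ->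
    homogeneous (p (+) q) (amul a b);
  aform_linear : forall b, scalar (aform ^~ b);
  aform_sym : forall a b, aform a b = aform b a;
  aform_odd : forall p a b, homogeneous p a -> homogeneous p b -> aform a b = 0;
  aform_invariant : forall a b c, aform (amul a b) c = aform a (amul b c);
  aform_nondegenerate : forall a, (forall b, aform a b = 0) -> a = 0
}.

Section OddAlgebra.
Variables (k : fieldType) (A : oddAlgebra k).
Local Notation A0 := (even_part A).
Local Notation A1 := (odd_part A).
Local Notation "a ** b" := (amul a b) (at level 40, left associativity).
Local Notation "<< a , b >>" := (aform a b).

Definition ev (a : A0) : A0 * A1 := (a, 0).
Definition od (x : A1) : A0 * A1 := (0, x).

Definition lie_ad (a x : A0) : A0 := (ev a ** ev x - ev x ** ev a).1.

Definition unimodular : Prop :=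
  forall a : A0,
    \tr (passmx.mxof (vbasis {:A0}) (vbasis {:A0}) (linfun (lie_ad a))) = 0.

(* m_A (pi a1, pi a2, pi a3), for a2 homogeneous of parity p2. *)
Definition mA (p2 : bool) (a1 a2 a3 : A0 * A1) : k :=
  (-1) ^+ p2.+1 * << a1 ** a2, a3 >>.

Record dual_bases (r : nat) (e : r.-tuple A0) (xi : 'I_r -> A1) : Prop :=
  DualBases {
    dual_bases_even : basis_of {:A0} e;
    dual_bases_odd : forall x : A1,
      exists! c : {ffun 'I_r -> k}, x = \sum_i c i *: xi i;
    dual_basesE : forall i j, << ev (tnth e i), od (xi j) >> = (i == j)%:R
  }.

Section MatrixModel.
Variables (r N : nat) (e : r.-tuple A0) (xi : 'I_r -> A1).

(* (alpha, i, j) indexes the coordinate X_i^{alpha,j}, and also the          *)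
(* coordinate Y_{alpha,i}^j: lower indices number rows.                      *)
Local Notation idx := ('I_r * 'I_N * 'I_N)%type.
(* Functions of (X, Y); X is inl and Y is inr. *)
Local Notation fn := (fps (idx + idx)%type k).
(* Forms in X, respectively polyvector fields in X, depending on Y. *)
Local Notation form := (ext idx fn).
Local Notation polyvector := (ext idx fn).

Let eb (b : 'I_r) : A0 * A1 := ev (tnth e b).
Let xb (b : 'I_r) : A0 * A1 := od (xi b).

Definition mX (b : 'I_r) : 'M[fn]_N :=
  \matrix_(i, j) fpsX (inl (b, i, j) : idx + idx).

Definition mY (b : 'I_r) : 'M[fn]_N :=
  \matrix_(i, j) fpsX (inr (b, i, j) : idx + idx).

(* The entry with lower index j and upper index i is d/d(X^b)_i^j. *)
Definition mD (b : 'I_r) : 'M[polyvector]_N :=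
  \matrix_(j, i) extX (b, i, j).

Definition cst_mx (M : 'M[k]_N) : 'M[fn]_N :=
  map_mx (@fpsC (idx + idx)%type k) M.

Definition cubic : fn :=
  fpsC (3`!%:R)^-1 *
  \sum_a \sum_b \sum_c
    fpsC (mA true (xb a) (xb b) (xb c)) * \tr (mX a *m mX b *m mX c).

(* The linear Poisson bivector of the Lie algebra A_0 (x) gl_N. Since        *)
(* d/dX^b /\ d/dX^c is not halved by its antisymmetry, the full sum over b   *)
(* and c, with coefficient 1, is the bivector whose contraction with         *)
(* d(Tr <Y, X>) is the vector field [Y, X]; coefficient 1/2 would give       *)
(* [Y, X] / 2, and exp (Tr <Y, X>) Psi would not be equivariantly closed.    *)
Definition bivector : polyvector :=
  \sum_a \sum_b \sum_c
    extC (fpsC (mA false (xb a) (eb b) (eb c))) *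
      \tr (map_mx extC (mX a) *m mD b *m mD c).

Definition Psi (lambda : k) : form :=
  contract (ext_exp (extC cubic + bivector))
           (extC (fpsC lambda) * ext_top).

Definition trYX : fn :=
  \sum_a \sum_b fpsC << eb a, xb b >> * \tr (mY a *m mX b).

(* The components of [a (x) M, Z] for Z = X (a point of Pi A_1 (x) gl_N), and *)
(* for Z = Y (a point of A_0 (x) gl_N). By duality of the bases, the          *)
(* coordinate of x in A_1 along xi_c is <<x, e^c>>, and that of x in A_0      *)
(* along e^c is <<x, xi_c>>.                                                  *)
Definition coad (a : A0) (M : 'M[k]_N) (c : 'I_r) : 'M[fn]_N :=
  \sum_b (fpsC << ev a ** xb b, eb c >> *: (cst_mx M *m mX b)
          - fpsC << xb b ** ev a, eb c >> *: (mX b *m cst_mx M)).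

Definition ad (a : A0) (M : 'M[k]_N) (c : 'I_r) : 'M[fn]_N :=
  \sum_b (fpsC << ev a ** eb b, xb c >> *: (cst_mx M *m mY b)
          - fpsC << eb b ** ev a, xb c >> *: (mY b *m cst_mx M)).

Definition coad_field (a : A0) (M : 'M[k]_N) : polyvector :=
  \sum_c \sum_i \sum_j extC (coad a M c i j) * extX (c, i, j).

Definition ad_deriv (a : A0) (M : 'M[k]_N) (f : fn) : fn :=
  \sum_c \sum_i \sum_j
    ad a M c i j * fps_deriv (inr (c, i, j) : idx + idx) f.

Definition dDR (w : form) : form :=
  \sum_(v : idx) extX v * ext_map (fps_deriv (inl v)) w.

Definition lie_derivative (V : polyvector) (w : form) : form :=
  dDR (contract V w) + contract V (dDR w).

(* Invariance under the Lie algebra A_0 (x) gl_N, acting on X and Y; it is   *)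
(* linear in the element of the Lie algebra, hence the pure tensors.         *)
Definition equivariant_form (w : form) : Prop :=
  forall (a : A0) (M : 'M[k]_N),
    lie_derivative (coad_field a M) w + ext_map (ad_deriv a M) w = 0.

(* delta_mx j l is E_l^j, the coefficient of Y_{b,j}^l in Y. *)
Definition d_equivariant (w : form) : form :=
  dDR w - \sum_b \sum_l \sum_j
    extC (mY b j l) * contract (coad_field (tnth e b) (delta_mx j l)) w.

End MatrixModel.
End OddAlgebra.

Arguments Psi {k A r} N e xi lambda.
Arguments trYX {k A r} N e xi.

(* Main.v *)
From HB Require Import structures.
From mathcomp.multinomials Require Import mpoly.
Require Import Defs.
From mathcomp Require Import all_boot all_order all_algebra.
From mathcomp Require Import boolp ring zify.

Set Implicit Arguments.
Unset Strict Implicit.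
Unset Printing Implicit Defensive.

Import GRing.Theory.
Local Open Scope ring_scope.

(** Let L be the associative algebra A_0 (x) gl_N, with the basis T_v dual to
   the coordinates x_v of Pi A_1 (x) gl_N: for v = (b, i, j), T_v is
   e^b (x) E with E the elementary matrix whose entry 1 is in row j and
   column i. Let C be the cubic function, B the bivector, G = C + B, and let G
   also denote the contraction with it. The coefficient of B on
   d/dx_u /\ d/dx_v is the linear function - x(T_u T_v), so that B is, up
   to sign, the linear Poisson structure of the Lie algebra of L.

   Exterior product by dX_v commutes with functions, and its commutator with
   the contraction by B is the contraction by the Hamiltonian vector field
   H_v = - sum_u x([T_v, T_u]) d/dx_u, which has no dX and no derivative in it
   and so commutes with G. As dX_v kills the top form, this yields the
   identity on which everything rests (extX_exp_quadratic):

     dX_v /\ Psi = H_v |- Psi.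

   Closedness of Psi. The commutator E = [d, G] is the sum over v of
   H_v d/dx_v + dX_v (d_v G), where d_v G differentiates the coefficients of
   G, and [E, G] = 2 sum_v H_v (d_v G). The part of this sum in d_v C says that
   C is a Casimir function of B, and the part in d_v B is the Jacobi identity
   (jacobi_casimir_linear_product); both follow from associativity. So E
   commutes with G, and d G^n top = n G^(n-1) E top. Finally E top is the
   contraction of top with the divergence of B, that is, with the functional
   T |-> tr ad T on L up to sign, which vanishes because A_0 is unimodular.

   Equivariant closedness. Let f = Tr <Y, X>. As d Psi = 0, d (e^f Psi) is
   e^f df /\ Psi = e^f sum_v (d_v f) H_v |- Psi. Since H_v is the co-adjoint
   field of T_v (coad_field_basis) and d_v f is the coordinate of Y along T_v,
   this is the contraction of e^f Psi with [Y, X].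

   Invariance. The co-adjoint field K of an element of L is a combination of
   the H_v with constant coefficients, so K |- Psi = eta /\ Psi with eta a
   constant 1-form. As eta /\ Psi is closed, the Lie derivative of Psi along
   K vanishes, and that of e^f Psi is K(f) e^f Psi. It is cancelled by the
   adjoint action on Y because f is invariant (trYX_invariant).

   The exponential series are compared with their partial sums modulo terms
   of high degree in X and Y (ext_limit_eq). *)

(** * Formal power series: derivations, order and exponential *)

Section PowerSeries.
Variables (V : finType) (R : comNzRingType).
Implicit Types (f g : fps V R) (m : 'X_{1..#|V|}).

Lemma fpsD f g m : (f + g) m = f m + g m. Proof. by []. Qed.
Lemma fpsB f g m : (f - g) m = f m - g m. Proof. by []. Qed.

Lemma fps_sumE (I : Type) (s : seq I) (P : pred I) (F : I -> fps V R) m :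
  (\sum_(i <- s | P i) F i) m = \sum_(i <- s | P i) F i m.
Proof.
by elim/big_rec2: _ => // i x y _ <-.
Qed.

Lemma fpsCM c f m : (fpsC c * f) m = c * f m.
Proof.
pose p := fps_trunc (mdeg m).+1 f.
rewrite [LHS](@fps_mulE V R (fpsC c) f m c%:MP p) => [|m' _|m' le_m'm].
- by rewrite mcoeffCM fps_truncE.
- by rewrite mcoeffC /fpsC; case: eqP; rewrite ?mulr1 ?mulr0.
- by rewrite fps_truncE.
Qed.

Fact fpsC_additive : zmod_morphism (@fpsC V R).
Proof.
by move=> a b; apply: funext => m; rewrite fpsB /fpsC; case: eqP; rewrite ?subr0.
Qed.
HB.instance Definition _ :=
  GRing.isZmodMorphism.Build R (fps V R) (@fpsC V R) fpsC_additive.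

Fact fpsC_multiplicative : monoid_morphism (@fpsC V R).
Proof.
split=> // a b; apply: funext => m; rewrite fpsCM /fpsC.
by case: eqP; rewrite ?mulr0.
Qed.
HB.instance Definition _ :=
  GRing.isMonoidMorphism.Build R (fps V R) (@fpsC V R) fpsC_multiplicative.

Fact fps_deriv_additive v : zmod_morphism (@fps_deriv V R v).
Proof. by move=> f g; apply: funext => m; rewrite fpsB /fps_deriv fpsB mulrnBl. Qed.
HB.instance Definition _ (v : V) :=
  GRing.isZmodMorphism.Build (fps V R) (fps V R) (@fps_deriv V R v)
    (fps_deriv_additive v).

Lemma fps_derivN v f : fps_deriv v (- f) = - fps_deriv v f.
Proof. exact: raddfN. Qed.

(** The coefficients of degree at most that of m involve only finite
   truncations, and for polynomials the rule is known. *)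
Lemma fps_derivM v f g :
  fps_deriv v (f * g) = fps_deriv v f * g + f * fps_deriv v g.
Proof.
apply: funext => m; pose d := (mdeg m).+2; pose i := enum_rank v.
have dU m' : (mdeg m' <= mdeg m)%N -> (mdeg (m' + U_(i)) < d)%N.
  by rewrite mdegD mdeg1 addn1 ltnS.
have tr h m' : (mdeg m' <= mdeg m)%N -> (fps_trunc d h)@_m' = h m'.
  by move=> le_m'm; rewrite fps_truncE // ltnS (leq_trans le_m'm).
have trD h m' : (mdeg m' <= mdeg m)%N ->
    ((fps_trunc d h)^`M(i))@_m' = fps_deriv v h m'.
  by move=> le_m'm; rewrite mcoeff_deriv fps_truncE ?dU.
transitivity (((fps_trunc d f * fps_trunc d g)^`M(i))@_m).
  by rewrite mcoeff_deriv -(@fps_mul_trunc _ _ f g) ?dU.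
rewrite mderivM mcoeffD fpsD; congr (_ + _); apply/esym/fps_mulE;
  by move=> m' le_m'm; rewrite ?tr ?trD.
Qed.

Lemma fps_derivC v (c : R) : fps_deriv v (fpsC c) = 0 :> fps V R.
Proof.
apply: funext => m; rewrite /fps_deriv /fpsC.
case: eqP => [/(congr1 (fun m => mdeg m))|_]; last by rewrite mul0rn.
by rewrite mdegD mdeg1 mdeg0 addn1.
Qed.

Lemma fps_derivX (v w : V) : fps_deriv v (fpsX w) = (v == w)%:R :> fps V R.
Proof.
apply: funext => m; rewrite /fps_deriv /fpsX.
have [<-|nvw] := eqVneq v w.
  have -> : (m + U_(enum_rank v) == U_(enum_rank v))%MM = (m == 0%MM).
    by rewrite -[X in _ == X]add0m; apply/eqP/eqP => [/addIm|->].
  by rewrite -[1%:R]/(fpsC 1) /fpsC; case: eqP => [->|_]; rewrite ?mul0rn ?mnm0E ?mulr1n.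
have /negPf-> : (m + U_(enum_rank v) != U_(enum_rank w))%MM; last by rewrite mul0rn.
apply/eqP => /mnmP/(_ (enum_rank v)); rewrite mnmDE !mnm1E eqxx.
by rewrite (inj_eq enum_rank_inj) eq_sym (negPf nvw) addn1.
Qed.

Lemma fps_derivXn v f n :
  fps_deriv v (f ^+ n.+1) = n.+1%:R * (f ^+ n * fps_deriv v f).
Proof.
elim: n => [|n IHn]; first by rewrite !expr1 expr0 !mul1r.
rewrite exprS fps_derivM IHn [f ^+ n.+1]exprS; ring.
Qed.

(** Series without terms of degree below d form an ideal, and a series lying in
   all these ideals is 0: identities may be checked modulo each of them. *)
Definition order_ge d f := forall m, (mdeg m < d)%N -> f m = 0.

Lemma order_geW d e f : (d <= e)%N -> order_ge e f -> order_ge d f.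
Proof. by move=> le_de hf m lt_md; apply: hf; apply: leq_trans le_de. Qed.

Lemma order_geD d f g : order_ge d f -> order_ge d g -> order_ge d (f + g).
Proof. by move=> hf hg m lt_md; rewrite fpsD hf ?hg ?addr0. Qed.

Lemma order_geN d f : order_ge d f -> order_ge d (- f).
Proof. by move=> hf m lt_m; rewrite -sub0r fpsB hf ?subrr. Qed.

Lemma order_ge_sum d (I : Type) (s : seq I) (P : pred I) (F : I -> fps V R) :
  (forall i, P i -> order_ge d (F i)) -> order_ge d (\sum_(i <- s | P i) F i).
Proof. by move=> oF; apply: big_ind => //; apply: order_geD. Qed.

Lemma order_geM d e f g :
  order_ge d f -> order_ge e g -> order_ge (d + e) (f * g).
Proof.
move=> hf hg m lt_m; apply: big1 => -[[m1 h1] [m2 h2]] /= /eqP m_eq.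
have [lt_d|le_d] := ltnP (mdeg m1) d; first by rewrite hf ?mul0r.
rewrite [g _]hg ?mulr0 // -(ltn_add2l d).
by apply: leq_ltn_trans lt_m; rewrite m_eq mdegD leq_add2r.
Qed.

Lemma order_geMr d f g : order_ge d f -> order_ge d (f * g).
Proof. by move=> hf; rewrite -[d]addn0; apply: order_geM. Qed.

Lemma order_geMl d f g : order_ge d g -> order_ge d (f * g).
Proof. by rewrite mulrC; apply: order_geMr. Qed.

Lemma order_geX f n : order_ge 1 f -> order_ge n (f ^+ n).
Proof.
move=> hf; elim: n => [|n IHn]; first by [].
by rewrite exprS -add1n; apply: order_geM.
Qed.

Lemma order_ge_fpsX (v : V) : order_ge 1 (fpsX v : fps V R).
Proof.
move=> m; rewrite /fpsX ltnS leqn0 mdeg_eq0 => /eqP->.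
case: eqP => // /(congr1 (fun m => mdeg m)).
by rewrite mdeg1 mdeg0.
Qed.

Lemma order_ge_deriv d v f : order_ge d.+1 f -> order_ge d (fps_deriv v f).
Proof.
by move=> hf m lt_m; rewrite /fps_deriv hf ?mul0rn // mdegD mdeg1 addn1.
Qed.

Lemma order_ge_eq0 f : (forall d, order_ge d f) -> f = 0.
Proof. by move=> hf; apply: funext => m; apply: (hf (mdeg m).+1). Qed.

End PowerSeries.

Section FpsExp.
Variables (V : finType) (k : fieldType).
Hypothesis char0 : [pchar k] =i pred0.
Variable f : fps V k.
Hypothesis hf : order_ge 1 f.

Let exp_trunc d : fps V k := \sum_(n < d) fpsC (n`!%:R)^-1 * f ^+ n.

Lemma fps_exp_trunc d : order_ge d (fps_exp f - exp_trunc d).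
Proof.
move=> m lt_md; apply/eqP; rewrite fpsB subr_eq0 /exp_trunc fps_sumE.
apply/eqP; rewrite /fps_exp.
rewrite (eq_bigr (fun n : 'I__ => (fpsC (n`!%:R)^-1 * f ^+ n) m)); last first.
  by move=> n _; rewrite fpsCM.
rewrite (big_ord_widen d (fun n => (fpsC (n`!%:R)^-1 * f ^+ n) m) lt_md).
rewrite [RHS](bigID (fun n : 'I_d => n < (mdeg m).+1)%N) /= [X in _ + X]big1 ?addr0 //.
by move=> n; rewrite -leqNgt => lt_mn; rewrite fpsCM order_geX ?mulr0.
Qed.

Lemma inv_fact_succ n : (n.+1`!%:R)^-1 * n.+1%:R = (n`!%:R)^-1 :> k.
Proof.
rewrite factS natrM invfM mulrAC mulVf ?mul1r //.
by rewrite (pcharf0P k).1.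
Qed.

(** Differentiation lowers the order by 1, and exactly maps a partial sum with
   d + 1 terms to f' times the partial sum with d terms. *)
Lemma fps_deriv_exp v : fps_deriv v (fps_exp f) = fps_deriv v f * fps_exp f.
Proof.
apply/eqP; rewrite -subr_eq0; apply/eqP/order_ge_eq0 => d.
have -> : fps_deriv v (fps_exp f) - fps_deriv v f * fps_exp f
   = fps_deriv v (fps_exp f - exp_trunc d.+1)
     + - fps_deriv v f * (fps_exp f - exp_trunc d).
  have -> : fps_deriv v (fps_exp f - exp_trunc d.+1) =
     fps_deriv v (fps_exp f) - fps_deriv v f * exp_trunc d; last by ring.
  rewrite raddfB; congr (_ - _).
  rewrite /exp_trunc big_ord_recl raddfD /= expr0 mulr1 fps_derivC add0r.
  rewrite raddf_sum mulr_sumr; apply: eq_bigr => n _ /=.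
  rewrite fps_derivM fps_derivC fps_derivXn mul0r add0r.
  rewrite -(rmorph_nat (@fpsC V k)) mulrA -rmorphM /= inv_fact_succ; ring.
apply: order_geD; last exact/order_geMl/fps_exp_trunc.
exact/order_ge_deriv/fps_exp_trunc.
Qed.

End FpsExp.

(** * Exterior algebra and contractions *)
Lemma sum_delta (R : pzSemiRingType) (I : finType) (j : I) (F : I -> R) :
  \sum_i (i == j)%:R * F i = F j.
Proof.
rewrite (bigD1 j) //= eqxx mul1r big1 ?addr0 // => i /negPf->.
exact: mul0r.
Qed.

Lemma sum_delta_sym (R : pzSemiRingType) (I : finType) (j : I) (F : I -> R) :
  \sum_i (j == i)%:R * F i = F j.
Proof. by rewrite -[RHS]sum_delta; under eq_bigr do rewrite eq_sym. Qed.

Lemma bin2D m n : 'C(m + n, 2) = ('C(m, 2) + 'C(n, 2) + m * n)%N.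
Proof.
elim: n => [|n IHn]; first by rewrite addn0 muln0 !addn0.
rewrite addnS !binS !bin1 IHn mulnS; lia.
Qed.

Lemma disjUl (T : finType) (A B C : {set T}) :
  [disjoint A :|: B & C] = [disjoint A & C] && [disjoint B & C].
Proof. by rewrite -!setI_eq0 setIUl setU_eq0. Qed.

Lemma disjUr (T : finType) (A B C : {set T}) :
  [disjoint C & A :|: B] = [disjoint C & A] && [disjoint C & B].
Proof. by rewrite ![[disjoint C & _]]disjoint_sym disjUl. Qed.

Section ExteriorAlgebra.
Variables (V : finType) (R : comNzRingType).
Implicit Types (J K L M : {set V}) (g h u w : ext V R) (c : R) (a b v : V).

Lemma extE u w J : (u * w) J =
  \sum_(K : {set V} | K \subset J) (-1) ^+ ext_inv K (J :\: K) * u K * w (J :\: K).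
Proof. by rewrite ffunE. Qed.

Lemma ext_sumE (I : Type) (s : seq I) (P : pred I) (F : I -> ext V R) J :
  (\sum_(i <- s | P i) F i) J = \sum_(i <- s | P i) F i J.
Proof. by rewrite sum_ffunE. Qed.

Lemma extBE u w J : (u - w) J = u J - w J.
Proof. by rewrite !ffunE. Qed.

Lemma extCE c J : extC c J = if J == set0 then c else 0 :> R.
Proof. by rewrite ffunE. Qed.

Lemma extCM c w J : (extC c * w) J = c * w J.
Proof.
rewrite extE (bigD1 set0) ?sub0set //= big1 => [|K /andP[_ /negPf nK0]].
  by rewrite extCE eqxx ext_inv0l setD0 mul1r addr0.
by rewrite extCE nK0 mulr0 mul0r.
Qed.

Lemma extC_comm c w : extC c * w = w * extC c.
Proof.
apply/ffunP => J; rewrite extCM extE (bigD1 J) //= big1 => [|K /andP[sKJ nKJ]].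
  by rewrite extCE setDv eqxx ext_inv0r mul1r addr0 mulrC.
rewrite extCE setD_eq0; case: ifP => [sJK|_]; last by rewrite mulr0.
by rewrite eqEsubset sKJ sJK in nKJ.
Qed.

Lemma extC_mulCA c d w : extC c * (extC d * w) = extC d * (extC c * w).
Proof. by rewrite !mulrA (extC_comm c). Qed.

Lemma extC_mulAC c u w : u * (extC c * w) = extC c * (u * w).
Proof. by rewrite mulrA -extC_comm mulrA. Qed.

Fact extC_additive : zmod_morphism (@extC V R).
Proof.
by move=> a b; apply/ffunP => J; rewrite !ffunE; case: eqP; rewrite ?subr0.
Qed.
HB.instance Definition _ :=
  GRing.isZmodMorphism.Build R (ext V R) (@extC V R) extC_additive.

Fact extC_multiplicative : monoid_morphism (@extC V R).
Proof.
split=> // a b; apply/ffunP => J; rewrite extCM !extCE.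
by case: eqP; rewrite ?mulr0.
Qed.
HB.instance Definition _ :=
  GRing.isMonoidMorphism.Build R (ext V R) (@extC V R) extC_multiplicative.

Lemma extXM v w J :
  (extX v * w) J = if v \in J then (-1) ^+ ext_inv [set v] (J :\ v) * w (J :\ v)
                   else 0.
Proof.
rewrite extE; case: ifP => [vJ|/negbT nvJ].
  rewrite (bigD1 [set v]) ?sub1set //= big1 => [|K /andP[_ /negPf nKv]].
    by rewrite ffunE eqxx mulr1 addr0.
  by rewrite ffunE nKv mulr0 mul0r.
apply: big1 => K sKJ; rewrite ffunE; case: eqP => [K_v|_].
  by rewrite K_v sub1set (negPf nvJ) in sKJ.
by rewrite mulr0 mul0r.
Qed.

Lemma extX_top v : extX v * ext_top = 0 :> ext V R.
Proof.
apply/ffunP => J; rewrite extXM !ffunE; case: ifP => // _.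
case: eqP => [/setP/(_ v)|_]; last by rewrite mulr0.
by rewrite !inE eqxx.
Qed.

(** Each pair of elements of K and L is an inversion in exactly one of the two
   orders. *)
Lemma ext_inv_swap K L : [disjoint K & L] ->
  (ext_inv K L + ext_inv L K = #|K| * #|L|)%N.
Proof.
move=> dKL; rewrite [ext_inv L K]/ext_inv exchange_big /ext_inv -big_split /=.
rewrite -sum_nat_const; apply: eq_bigr => a aK; rewrite -big_split /=.
transitivity (\sum_(b in L) 1)%N; last by rewrite sum1_card.
apply: eq_bigr => b bL; case: (ltngtP (enum_rank b) (enum_rank a)) => //.
move=> /val_inj/enum_rank_inj ba; move/pred0P/(_ a): dKL => /=.
by rewrite aK -ba bL.
Qed.

Lemma ext_inv1_swap a b : a != b ->
  (ext_inv [set a] [set b] + ext_inv [set b] [set a] = 1)%N.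
Proof. by move=> nab; rewrite ext_inv_swap ?cards1 // disjoints1 inE. Qed.

Lemma extX_anticomm a b : extX a * extX b = - (extX b * extX a) :> ext V R.
Proof.
have [->|nab] := eqVneq a b.
  suff -> : extX b * extX b = 0 :> ext V R by rewrite oppr0.
  apply/ffunP => J; rewrite extXM !ffunE; case: ifP => // _.
  case: eqP => [/setP/(_ b)|_]; last by rewrite mulr0.
  by rewrite !inE eqxx.
have nba : b != a by rewrite eq_sym.
suff XE x y J : x != y ->
    (extX x * extX y) J = (J == [set x; y])%:R * (-1) ^+ ext_inv [set x] [set y] :> R.
  apply/ffunP => J; rewrite [RHS]ffunE !XE // [in RHS]setUC -mulrN; congr (_ * _).
  rewrite -[ext_inv [set b] _](addnK (ext_inv [set a] [set b])) addnC.
  rewrite -signr_odd -[in RHS]signr_odd oddB; last by rewrite leq_addr.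
  rewrite ext_inv1_swap //; case: (odd _); rewrite ?opprK //.
move=> nxy; rewrite extXM ffunE; have [xJ|nxJ] := boolP (x \in J); last first.
  case: eqP => [J_xy|_]; last by rewrite mul0r.
  by rewrite J_xy !inE eqxx in nxJ.
have -> : (J :\ x == [set y]) = (J == [set x; y]).
  apply/eqP/eqP => [<-|->]; first by rewrite setD1K.
  by rewrite setU1K // inE.
by case: eqP => [->|_]; rewrite ?mulr0 ?mul0r // setU1K ?inE // mulrC.
Qed.

Lemma pairwise_enum K : pairwise (fun a b => enum_rank a < enum_rank b)%N (enum K).
Proof.
have -> : enum K = filter (mem K) (enum V) by rewrite enumT.
apply: pairwise_filter.
have [v _|V0] := pickP (mem V); last first.
  by case: (enum V) => // v s; have := V0 v.
apply/(pairwiseP v) => i j; rewrite !inE -cardE => lt_i lt_j lt_ij.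
have rk n (lt_n : (n < #|V|)%N) : enum_rank (nth v (enum V) n) = n :> nat.
  by rewrite -[n]/(val (Ordinal lt_n)) -enum_val_nth enum_valK.
by rewrite !rk.
Qed.

(** Moving a set K of k generators past each other and then past L costs
   k (k - 1) / 2 inversions inside K, because the successive interior products
   are taken in the increasing order of K. *)
Lemma foldr_iprod (s : seq V) w L :
    pairwise (fun a b => enum_rank a < enum_rank b)%N s ->
  foldr (@iprod V R) w s L =
    if [disjoint [set:: s] & L] then
      (-1) ^+ (ext_inv [set:: s] L + 'C(size s, 2)) * w ([set:: s] :|: L)
    else 0.
Proof.
elim: s L => [|v s IHs] L /=.
  have -> : [set:: [::]] = set0 :> {set V} by apply/setP => x; rewrite !inE.
  by rewrite -setI_eq0 set0I eqxx ext_inv0l set0U mul1r.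
move=> /andP[/allP lt_v pw_s]; rewrite ffunE set_cons.
have vNs : [disjoint [set v] & [set:: s]].
  by rewrite disjoints1 inE; apply/negP => /lt_v; rewrite ltnn.
have inv_sv : ext_inv [set:: s] [set v] = size s.
  rewrite /ext_inv; under eq_bigr => a _ do rewrite big_set1.
  rewrite (eq_bigr (fun=> 1%N)) => [|a]; last by rewrite inE => /lt_v->.
  rewrite sum1_card; have /card_uniqP <- : uniq s.
    by apply: pairwise_uniq pw_s => a; rewrite ltnn.
  by apply: eq_card => a; rewrite inE.
rewrite disjUl disjoints1; case: ifP => vL //=; rewrite IHs // disjUr.
rewrite [X in X && _]disjoint_sym vNs /=; case: ifP => // dsL; last by rewrite mulr0.
rewrite setUCA setUA mulrA -exprD; congr (_ ^+ _ * _).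
rewrite ext_invUl // ext_invUr ?disjoints1 ?vL // inv_sv binS bin1; lia.
Qed.

Lemma contractE g w L : contract g w L =
  \sum_(K : {set V} | [disjoint K & L])
    (-1) ^+ (ext_inv K L + 'C(#|K|, 2)) * g K * w (K :|: L).
Proof.
rewrite /contract ext_sumE [RHS]big_mkcond /=; apply: eq_bigr => K _.
rewrite extCM foldr_iprod ?pairwise_enum // set_enum -cardE.
by case: ifP => _; rewrite ?mulr0 // mulrCA mulrA.
Qed.

(** Forms are a module over the algebra of polyvector fields; this is what
   turns identities between operators into identities in that algebra. With
   the signs of contractE, it amounts to
   binomial(k + m, 2) = binomial(k, 2) + binomial(m, 2) + k m together with
   ext_inv_swap. *)
Lemma contract_mul g h w : contract (g * h) w = contract g (contract h w).
Proof.
apply/ffunP => L; rewrite !contractE.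
transitivity (\sum_(J : {set V} | [disjoint J & L]) \sum_(K : {set V} | K \subset J)
   (-1) ^+ (ext_inv J L + 'C(#|J|, 2) + ext_inv K (J :\: K))
     * g K * h (J :\: K) * w (J :|: L)).
  apply: eq_bigr => J _; rewrite extE mulr_sumr mulr_suml.
  by apply: eq_bigr => K _; rewrite [in RHS]exprD !mulrA.
transitivity (\sum_(K : {set V} | [disjoint K & L])
    \sum_(M : {set V} | [disjoint M & K :|: L])
   (-1) ^+ (ext_inv K L + 'C(#|K|, 2) + (ext_inv M (K :|: L) + 'C(#|M|, 2)))
     * g K * h M * w (M :|: (K :|: L))); last first.
  apply: eq_bigr => K _; rewrite contractE mulr_sumr; apply: eq_bigr => M _.
  by rewrite !exprD; ring.
rewrite (exchange_big_dep (fun K : {set V} => [disjoint K & L])) /=; last first.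
  by move=> J K dJL sKJ; apply: disjointWl dJL.
apply: eq_bigr => K dKL.
rewrite (reindex_onto (fun M => K :|: M) (fun J => J :\: K)) /=; last first.
  by move=> J /andP[_ sKJ]; rewrite setDE setUIr setUCr setIT; apply/setUidPr.
apply: eq_big => [M | M].
  rewrite disjUl dKL subsetUl andbT /= disjUr andbC; congr (_ && _).
  rewrite setDUl setDv set0U -setI_eq0.
  by apply/eqP/eqP => [/setDidPl|]; rewrite -?setI_eq0;
    [move/eqP | move/eqP; rewrite setI_eq0 => /setDidPl].
move=> /andP[/andP[dKML _] /eqP KM_K].
have dMK : [disjoint M & K].
  rewrite -KM_K -setI_eq0; apply/eqP/setP => x.
  by rewrite !inE; case: (x \in K); rewrite ?andbF.
have dKM : [disjoint K & M] by rewrite disjoint_sym.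
rewrite KM_K setUCA setUA; congr (_ * _ * _ * _).
have -> : #|K :|: M| = (#|K| + #|M|)%N by rewrite cardsU (disjoint_setI0 dKM) cards0 subn0.
rewrite ext_invUl // ext_invUr // bin2D -(ext_inv_swap dKM).
rewrite -signr_odd -[in RHS]signr_odd; congr (_ ^+ nat_of_bool _).
by lia.
Qed.

Fact contract_additive g : zmod_morphism (contract g).
Proof.
move=> u w; apply/ffunP => L; rewrite extBE !contractE -sumrB.
by apply: eq_bigr => K _; rewrite extBE mulrBr.
Qed.
HB.instance Definition _ g :=
  GRing.isZmodMorphism.Build (ext V R) (ext V R) (@contract V R g)
    (contract_additive g).

Lemma contractDl g h w : contract (g + h) w = contract g w + contract h w.
Proof.
apply/ffunP => L; rewrite [RHS]ffunE !contractE -big_split /=.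
by apply: eq_bigr => K _; rewrite !ffunE mulrDr mulrDl.
Qed.

Lemma contract0l w : contract 0 w = 0.
Proof. by apply: (addrI (contract 0 w)); rewrite -contractDl !addr0. Qed.

Lemma contractBl g h w : contract (g - h) w = contract g w - contract h w.
Proof. by apply/eqP; rewrite eq_sym subr_eq -contractDl subrK. Qed.

Lemma contract_suml (I : Type) (s : seq I) (P : pred I) (F : I -> ext V R) w :
  contract (\sum_(i <- s | P i) F i) w = \sum_(i <- s | P i) contract (F i) w.
Proof.
by elim/big_rec2: _ => [|i x y _ <-]; rewrite ?contract0l ?contractDl.
Qed.

Lemma contract_sumr (I : Type) (s : seq I) (P : pred I) g (F : I -> ext V R) :
  contract g (\sum_(i <- s | P i) F i) = \sum_(i <- s | P i) contract g (F i).
Proof. exact: raddf_sum. Qed.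

Lemma contractC c w : contract (extC c) w = extC c * w.
Proof.
apply/ffunP => L; rewrite contractE (bigD1 set0) /=; last first.
  by rewrite -setI_eq0 set0I.
rewrite big1 => [|K /andP[_ /negPf nK0]]; last first.
  by rewrite extCE nK0 mulr0 mul0r.
by rewrite extCE eqxx ext_inv0l cards0 set0U mul1r addr0 extCM.
Qed.

Lemma contractCM c g w : contract (extC c * g) w = extC c * contract g w.
Proof. by rewrite contract_mul contractC. Qed.

Lemma contractMC g c w : contract g (extC c * w) = extC c * contract g w.
Proof. by rewrite -contractC -contract_mul -extC_comm contractCM. Qed.

Lemma contractX v w : contract (extX v) w = iprod v w.
Proof.
apply/ffunP => L; rewrite contractE ffunE; case: ifP => [vL|/negbT nvL].
  apply: big1 => K dKL; rewrite ffunE; case: eqP => [K_v|_].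
    by rewrite K_v disjoints1 vL in dKL.
  by rewrite mulr0 mul0r.
rewrite (bigD1 [set v]) ?disjoints1 //= big1 => [|K /andP[_ /negPf nKv]].
  by rewrite ffunE eqxx cards1 addn0 mulr1 addr0.
by rewrite ffunE nKv mulr0 mul0r.
Qed.

(** The canonical anticommutation relations between exterior and interior
   products. *)
Lemma extX_contractX a v w :
  extX v * contract (extX a) w = (a == v)%:R * w - contract (extX a) (extX v * w).
Proof.
rewrite !contractX; apply/ffunP => J; rewrite extBE.
have -> : ((a == v)%:R * w) J = if a == v then w J else 0.
  by case: eqP; rewrite ?mul1r ?mul0r // ffunE.
rewrite extXM ![iprod a _ _]ffunE extXM !inE.
have [->|nav] := eqVneq a v.
  case: ifP => vJ /=; rewrite ?setD1K ?setU1K ?vJ // mulrA -exprD.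
    by rewrite -signr_odd addnn odd_double mul1r subr0.
  by rewrite -signr_odd addnn odd_double mul1r subrr.
rewrite /= sub0r; case: ifP => vJ; last by rewrite mulr0 if_same oppr0.
case: ifP => aJ; first by rewrite mulr0 oppr0.
have -> : (a |: J) :\ v = a |: (J :\ v).
  by apply/setP => x; rewrite !inE; case: (eqVneq x a) => // ->; rewrite nav.
rewrite ![(-1) ^+ _ * (_ * _)]mulrA -mulNr; congr (_ * _).
have aJv : [disjoint [set a] & J :\ v] by rewrite disjoints1 !inE aJ andbF.
have vJv : [disjoint [set v] & J :\ v] by rewrite disjoints1 !inE eqxx.
have -> : ext_inv [set a] J = (ext_inv [set a] [set v] + ext_inv [set a] (J :\ v))%N.
  by rewrite -ext_invUr // setD1K.
rewrite [ext_inv [set v] (a |: _)]ext_invUr //.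
have := ext_inv1_swap nav.
rewrite -!exprD addnACA => ->; rewrite add1n exprS mulN1r opprK.
by rewrite addnC.
Qed.

(** Contraction by a vector field is an antiderivation on products with the
   basic 1-forms. *)
Lemma contract_vector_extX (F : V -> R) v w :
  contract (\sum_a extC (F a) * extX a) (extX v * w) =
  extC (F v) * w - extX v * contract (\sum_a extC (F a) * extX a) w.
Proof.
rewrite !contract_suml mulr_sumr.
rewrite -[extC (F v) * w](sum_delta v (fun a => extC (F a) * w)).
rewrite -sumrB; apply: eq_bigr => a _; rewrite !contractCM.
rewrite [extX v * (extC _ * _)]mulrA -[extX v * extC _]extC_comm.
rewrite -[extC _ * extX v * _]mulrA extX_contractX mulrBr opprB addrCA.
by case: eqP => _; rewrite ?mul1r ?mul0r ?mulr0 subrr addr0.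
Qed.

End ExteriorAlgebra.

(** * Derivations of the coefficients *)
Section CoefficientDerivation.
Variables (V : finType) (R : comNzRingType).
Implicit Types (g u w : ext V R).

Fact ext_map_additive (D : {additive R -> R}) : zmod_morphism (@ext_map V R D).
Proof. by move=> u w; apply/ffunP => J; rewrite extBE !ffunE raddfB. Qed.
HB.instance Definition _ (D : {additive R -> R}) :=
  GRing.isZmodMorphism.Build (ext V R) (ext V R) (@ext_map V R D)
    (ext_map_additive D).

Variable D : {additive R -> R}.
Hypothesis DM : forall a b, D (a * b) = D a * b + a * D b.

Let derivation1 : D 1 = 0.
Proof. by apply: (addrI (D 1)); rewrite addr0 -{3}[1]mulr1 DM mulr1 mul1r. Qed.

Lemma ext_mapC c : ext_map D (extC c) = extC (D c) :> ext V R.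
Proof. by apply/ffunP => J; rewrite !ffunE; case: eqP; rewrite ?raddf0. Qed.

Lemma ext_map_top : ext_map D ext_top = 0 :> ext V R.
Proof. by apply/ffunP => J; rewrite !ffunE; case: eqP; rewrite ?raddf0. Qed.

Lemma ext_mapX (v : V) : ext_map D (extX v) = 0 :> ext V R.
Proof. by apply/ffunP => J; rewrite !ffunE; case: eqP; rewrite ?raddf0. Qed.

Lemma ext_mapM u w :
  ext_map D (u * w) = ext_map D u * w + u * ext_map D w.
Proof.
apply/ffunP => J; rewrite [RHS]ffunE ffunE !extE raddf_sum -big_split.
by apply: eq_bigr => K _ /=; rewrite !ffunE -!mulrA raddfMsign DM -mulrDr.
Qed.

Lemma ext_mapXM (v : V) w : ext_map D (extX v * w) = extX v * ext_map D w.
Proof. by rewrite ext_mapM ext_mapX mul0r add0r. Qed.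

Lemma ext_map_contract g w :
  ext_map D (contract g w) = contract (ext_map D g) w + contract g (ext_map D w).
Proof.
apply/ffunP => L; rewrite [RHS]ffunE ffunE !contractE raddf_sum -big_split.
by apply: eq_bigr => K _ /=; rewrite !ffunE -!mulrA raddfMsign DM -mulrDr.
Qed.

End CoefficientDerivation.

(** * A function plus a bivector acting on forms *)
Section QuadraticPolyvector.
Variables (V : finType) (R : comNzRingType).
Implicit Types (g w : ext V R) (C : R) (p : V -> V -> R) (a b v : V).

Definition quadratic C p : ext V R :=
  extC C + \sum_a \sum_b extC (p a b) * (extX a * extX b).

(** When p a b is half of the Poisson bracket of x_a and x_b, this is the
   Hamiltonian vector field of x_v; in general, the antisymmetrization of p
   gives the bracket. *)
Definition hamiltonian p v : ext V R :=
  \sum_u extC (p v u - p u v) * extX u.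

Lemma quadratic_eq0 C p :
  C = 0 -> (forall a b, p a b = 0) -> quadratic C p = 0.
Proof.
move=> -> p0; rewrite /quadratic raddf0 add0r.
by apply: big1 => a _; apply: big1 => b _; rewrite p0 raddf0 mul0r.
Qed.

Lemma comm_extC C g : GRing.comm g (extC C).
Proof. by rewrite /GRing.comm extC_comm. Qed.

Lemma quadratic_comm_extX C p v : GRing.comm (extX v) (quadratic C p).
Proof.
apply: commrD; first exact: comm_extC.
apply: commr_sum => a _; apply: commr_sum => b _.
apply: commrM; first exact: comm_extC.
rewrite /GRing.comm mulrA (extX_anticomm _ v a) mulNr -[_ * _ * extX b]mulrA.
by rewrite (extX_anticomm _ v b) mulrN opprK mulrA.
Qed.

Lemma quadratic_comm_hamiltonian C p q v :
  GRing.comm (quadratic C p) (hamiltonian q v).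
Proof.
apply: commr_sum => u _; apply: commrM; first exact: comm_extC.
exact/commr_sym/quadratic_comm_extX.
Qed.

Lemma quadratic_comm C p C' p' :
  GRing.comm (quadratic C p) (quadratic C' p').
Proof.
apply: commrD; first exact: comm_extC.
apply: commr_sum => a _; apply: commr_sum => b _.
apply: commrM; first exact: comm_extC.
by apply: commrM; apply/commr_sym/quadratic_comm_extX.
Qed.

(** The commutator of the product by a 1-form with the contraction by a
   bivector is the contraction by the vector field obtained by pairing them. *)
Lemma extX_quadratic C p v w :
  extX v * contract (quadratic C p) w =
  contract (quadratic C p) (extX v * w) + contract (hamiltonian p v) w.
Proof.
rewrite /quadratic !contractDl mulrDr -!addrA; congr (_ + _).
  by rewrite !contractC mulrA -extC_comm mulrA.
have XX a b : extX v * contract (extX a * extX b) w =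
    contract (extX a * extX b) (extX v * w)
    + ((a == v)%:R * contract (extX b) w - (b == v)%:R * contract (extX a) w).
  rewrite !contract_mul extX_contractX extX_contractX raddfB /= opprB.
  have -> : contract (extX a) ((b == v)%:R * w) = (b == v)%:R * contract (extX a) w.
    by case: eqP => _; rewrite ?mul1r ?mul0r ?raddf0.
  by rewrite addrCA.
have S a b : extX v * contract (extC (p a b) * (extX a * extX b)) w =
    contract (extC (p a b) * (extX a * extX b)) (extX v * w)
    + ((a == v)%:R * contract (extC (p a b) * extX b) w
       - (b == v)%:R * contract (extC (p a b) * extX a) w).
  rewrite !contractCM mulrA -extC_comm -mulrA XX !mulrDr; congr (_ + (_ + _)).
    by rewrite !mulrA; congr (_ * _); case: eqP; rewrite ?mulr1 ?mulr0 ?mul1r ?mul0r.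
  by rewrite mulrN !mulrA; congr (- (_ * _)); case: eqP; rewrite ?mulr1 ?mulr0 ?mul1r ?mul0r.
rewrite !contract_suml mulr_sumr.
under eq_bigr => a _ do rewrite contract_suml mulr_sumr
  (eq_bigr _ (fun b _ => S a b)) big_split /= -contract_suml.
rewrite big_split /=; congr (_ + _).
under eq_bigr => a _ do rewrite sumrB.
rewrite sumrB (bigD1 v) //= [X in _ + X - _]big1 ?addr0; last first.
  by move=> a /negPf nav; apply: big1 => b _; rewrite nav mul0r.
rewrite [X in _ - X]exchange_big [X in _ - X](bigD1 v) //=.
rewrite [X in _ - (_ + X)]big1 ?addr0; last first.
  by move=> a /negPf nav; apply: big1 => b _; rewrite nav mul0r.
rewrite -sumrB; apply: eq_bigr => u _.
by rewrite eqxx !mul1r !contractCM raddfB mulrBl.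
Qed.

Lemma ext_map_quadratic (D : {additive R -> R}) C p :
    (forall x y, D (x * y) = D x * y + x * D y) ->
  ext_map D (quadratic C p) = quadratic (D C) (fun a b => D (p a b)).
Proof.
move=> DM; rewrite /quadratic raddfD raddf_sum /= ext_mapC; congr (_ + _).
apply: eq_bigr => a _; rewrite raddf_sum; apply: eq_bigr => b _ /=.
by rewrite ext_mapM // ext_mapXM // ext_mapX // mulr0 mulr0 addr0 ext_mapC.
Qed.

End QuadraticPolyvector.

Section DeRham.
Variables (V : finType) (R : comNzRingType) (D : V -> {additive R -> R}).
Hypothesis DM : forall v a b, D v (a * b) = D v a * b + a * D v b.

Definition de_rham (w : ext V R) : ext V R := \sum_v extX v * ext_map (D v) w.

Fact de_rham_additive : zmod_morphism de_rham.
Proof.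
move=> u w; rewrite /de_rham -sumrB; apply: eq_bigr => v _.
by rewrite raddfB mulrBr.
Qed.
HB.instance Definition _ :=
  GRing.isZmodMorphism.Build (ext V R) (ext V R) de_rham de_rham_additive.

Lemma de_rham_sum (I : Type) (r : seq I) (P : pred I) (F : I -> ext V R) :
  de_rham (\sum_(i <- r | P i) F i) = \sum_(i <- r | P i) de_rham (F i).
Proof. exact: raddf_sum. Qed.

Lemma de_rhamCM (c : R) w :
  de_rham (extC c * w) = (\sum_v extC (D v c) * extX v) * w + extC c * de_rham w.
Proof.
rewrite /de_rham mulr_suml mulr_sumr -big_split; apply: eq_bigr => v _ /=.
by rewrite ext_mapM // ext_mapC // mulrDr !mulrA -!(extC_comm _ (extX v)).
Qed.

Lemma de_rhamXM (v : V) w : de_rham (extX v * w) = - (extX v * de_rham w).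
Proof.
rewrite /de_rham mulr_sumr -sumrN; apply: eq_bigr => u _.
by rewrite ext_mapXM // !mulrA extX_anticomm mulNr.
Qed.

Lemma de_rham_constM (c : V -> R) w : (forall u v, D u (c v) = 0) ->
  de_rham ((\sum_v extC (c v) * extX v) * w) =
  - ((\sum_v extC (c v) * extX v) * de_rham w).
Proof.
move=> Dc; rewrite !mulr_suml de_rham_sum -sumrN; apply: eq_bigr => v _.
rewrite -!mulrA de_rhamCM de_rhamXM big1 ?mul0r ?add0r ?mulrN // => u _.
by rewrite Dc raddf0 mul0r.
Qed.

Variables (C : R) (p : V -> V -> R) (w0 : ext V R).
Local Notation G := (quadratic C p).
Local Notation H := (hamiltonian p).
Local Notation dG v := (quadratic (D v C) (fun a b => D v (p a b))).

Hypothesis wedge_w0 : forall v, extX v * w0 = 0.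
Hypothesis const_w0 : forall v, ext_map (D v) w0 = 0.

(* The commutator of the de Rham differential with the contraction by G. *)
Let E w := \sum_v (contract (H v) (ext_map (D v) w) + extX v * contract (dG v) w).

Let de_rham_G w : de_rham (contract G w) = contract G (de_rham w) + E w.
Proof.
rewrite /de_rham raddf_sum -big_split; apply: eq_bigr => v _ /=.
rewrite ext_map_contract // ext_map_quadratic // mulrDr.
rewrite (extX_quadratic C p).
by rewrite [LHS]addrC -addrA.
Qed.

(** The field H v commutes with G, and the n + 1 commutators of dX_v with the
   factors of G^(n + 1) are all equal to it; dX_v itself kills w0. *)
Lemma extX_quadratic_exp v n :
  extX v * contract (G ^+ n.+1) w0 = contract (H v) (contract (G ^+ n) w0) *+ n.+1.
Proof.
elim: n => [|n IHn].
  by rewrite expr1 expr0 extX_quadratic wedge_w0 raddf0 add0r contractC mul1r.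
rewrite exprS contract_mul extX_quadratic {}IHn raddfMn /= -contract_mul.
by rewrite quadratic_comm_hamiltonian contract_mul -[contract G _]contract_mul -exprS -mulrSr.
Qed.

Hypothesis jacobi_casimir : \sum_v H v * dG v = 0.
Hypothesis divergence_free : forall u, \sum_v D v (p v u - p u v) = 0.

(* Both terms of E contribute the sum of the H v * dG v to its commutator with
   G. *)
Let E_G w : E (contract G w) = contract G (E w).
Proof.
suff -> : E (contract G w) = contract G (E w)
    + (contract (\sum_v H v * dG v) w + contract (\sum_v H v * dG v) w).
  by rewrite jacobi_casimir contract0l !addr0.
rewrite !contract_suml /E raddf_sum -!big_split; apply: eq_bigr => v _ /=.
rewrite ext_map_contract // ext_map_quadratic // raddfD /= -!contract_mul.
rewrite -[dG v * G]quadratic_comm [contract (G * dG v) w]contract_mul.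
rewrite extX_quadratic raddfD /= -!contract_mul.
by rewrite -[H v * G]quadratic_comm_hamiltonian [X in X + _ = _]addrC addrACA.
Qed.

(* On w0, E reduces to the divergence of the bivector. *)
Let E_w0 : E w0 = 0.
Proof.
rewrite /E big_split /= big1 ?add0r => [|v _]; last by rewrite const_w0 raddf0.
under eq_bigr => v _ do rewrite extX_quadratic wedge_w0 raddf0 add0r contract_suml.
rewrite exchange_big big1 // => u _.
under eq_bigr => v _ do rewrite -raddfB contractCM.
by rewrite -mulr_suml -raddf_sum divergence_free raddf0 mul0r.
Qed.

Lemma de_rham_quadratic_exp n : de_rham (contract (G ^+ n) w0) = 0.
Proof.
suff: de_rham (contract (G ^+ n) w0) = 0 /\ E (contract (G ^+ n) w0) = 0 by case.
elim: n => [|n [IHd IHE]].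
  rewrite expr0 contractC mul1r E_w0; split=> //.
  by apply: big1 => v _; rewrite const_w0 mulr0.
by rewrite exprS contract_mul de_rham_G E_G IHd IHE raddf0 addr0.
Qed.

End DeRham.

(** * Limits of forms and exponentials *)
Section ExtOrder.
Variables (V W : finType) (R : comNzRingType).
Implicit Types (g h w : ext V (fps W R)).

Definition ext_order_ge d w := forall J, order_ge d (w J).

Lemma ext_order_geB d g h :
  ext_order_ge d g -> ext_order_ge d h -> ext_order_ge d (g - h).
Proof.
move=> hg hh J m lt_md; rewrite extBE fpsB (hg J m lt_md) (hh J m lt_md).
exact: subrr.
Qed.

Lemma ext_order_geM d e g h :
  ext_order_ge d g -> ext_order_ge e h -> ext_order_ge (d + e) (g * h).
Proof.
move=> hg hh J; rewrite extE; apply: order_ge_sum => K _.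
by rewrite -mulrA; apply/order_geMl/order_geM.
Qed.

Lemma ext_order_geX g n : ext_order_ge 1 g -> ext_order_ge n (g ^+ n).
Proof.
move=> hg; elim: n => [|n IHn]; first by [].
by rewrite exprS -add1n; apply: ext_order_geM.
Qed.

Lemma ext_order_geMl d g h : ext_order_ge d h -> ext_order_ge d (g * h).
Proof. by move=> hh; rewrite -[d]add0n; apply: ext_order_geM. Qed.

Lemma ext_order_ge_contract d e g w :
  ext_order_ge d g -> ext_order_ge e w -> ext_order_ge (d + e) (contract g w).
Proof.
move=> hg hw L; rewrite contractE; apply: order_ge_sum => K _.
by rewrite -mulrA; apply/order_geMl/order_geM.
Qed.

Lemma ext_order_ge_contractl d g w :
  ext_order_ge d g -> ext_order_ge d (contract g w).
Proof. by move=> hg; rewrite -[d]addn0; apply: ext_order_ge_contract. Qed.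

Lemma ext_order_ge_contractr d g w :
  ext_order_ge d w -> ext_order_ge d (contract g w).
Proof. by move=> hg; rewrite -[d]add0n; apply: ext_order_ge_contract. Qed.

Lemma ext_order_ge_deriv d (v : W) w :
  ext_order_ge d.+1 w -> ext_order_ge d (ext_map (fps_deriv v) w).
Proof. by move=> hw J; rewrite ffunE; apply: order_ge_deriv. Qed.

Lemma ext_order_ge_sum d (I : Type) (s : seq I) (P : pred I)
    (F : I -> ext V (fps W R)) :
  (forall i, P i -> ext_order_ge d (F i)) ->
  ext_order_ge d (\sum_(i <- s | P i) F i).
Proof. by move=> hF J; rewrite ext_sumE; apply: order_ge_sum => i /hF. Qed.

Lemma ext_order_ge_eq0 w : (forall d, ext_order_ge d w) -> w = 0.
Proof.
move=> hw; apply/ffunP => J; rewrite ffunE.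
by apply: order_ge_eq0 => d; apply: hw.
Qed.

(** Continuous additive operators that agree on approximations of w agree at
   w. The shift of index is that of the derivative of an exponential: F may lose
   one degree, as derivations do, and removes one term from a partial sum. *)
Lemma ext_limit_eq (F F' : ext V (fps W R) -> ext V (fps W R)) w
    (T : nat -> ext V (fps W R)) :
    zmod_morphism F -> zmod_morphism F' ->
    (forall d u, ext_order_ge d.+1 u -> ext_order_ge d (F u)) ->
    (forall d u, ext_order_ge d u -> ext_order_ge d (F' u)) ->
    (forall d, ext_order_ge d (w - T d)) ->
    (forall d, F (T d.+1) = F' (T d)) ->
  F w = F' w.
Proof.
move=> FB F'B ordF ordF' limT FT; apply/eqP; rewrite -subr_eq0.
apply/eqP/ext_order_ge_eq0 => d.
have -> : F w - F' w = F (w - T d.+1) - F' (w - T d).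
  by rewrite FB F'B FT opprB addrA subrK.
by apply: ext_order_geB; [exact/ordF/limT | exact/ordF'/limT].
Qed.

Lemma ext_order_ge_extC d (f : fps W R) :
  order_ge d f -> ext_order_ge d (extC f : ext V (fps W R)).
Proof. by move=> hf J; rewrite extCE; case: eqP. Qed.

Lemma ext_order_ge_quadratic d C p :
  order_ge d C -> (forall a b, order_ge d (p a b)) ->
  ext_order_ge d (quadratic C p : ext V (fps W R)).
Proof.
move=> hC hp J; rewrite ffunE; apply: order_geD; first exact: ext_order_ge_extC.
rewrite ext_sumE; apply: order_ge_sum => a _.
rewrite ext_sumE; apply: order_ge_sum => b _.
by rewrite extCM; apply/order_geMr.
Qed.

End ExtOrder.

Lemma ext_expE (V W : finType) (k : fieldType) (g : ext V (fps W k)) J m :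
  ext_exp g J m = \sum_(n < (mdeg m).+1) (n`!%:R)^-1 * (g ^+ n) J m.
Proof. by rewrite ffunE. Qed.

Section ExpQuadratic.
Variables (V U : finType) (k : fieldType).
Hypothesis char0 : [pchar k] =i pred0.
Local Notation R := (fps (V + U)%type k).
Local Notation D v := (fps_deriv (inl v : V + U)).
Variables (C : R) (p : V -> V -> R).
Hypotheses (orderC : order_ge 1 C) (orderp : forall a b, order_ge 1 (p a b)).
Local Notation G := (quadratic C p).
Local Notation H := (hamiltonian p).

Let orderG : ext_order_ge 1 G.
Proof. exact: ext_order_ge_quadratic. Qed.

Lemma ext_exp_trunc d : ext_order_ge d
  (ext_exp G - \sum_(n < d) extC (fpsC (n`!%:R)^-1) * G ^+ n).
Proof.
move=> J m lt_md; apply/eqP; rewrite extBE fpsB subr_eq0 ext_sumE fps_sumE.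
have E n : (extC (fpsC (n`!%:R)^-1) * G ^+ n) J m = (n`!%:R)^-1 * (G ^+ n) J m.
  by rewrite extCM fpsCM.
apply/eqP; rewrite ext_expE; under eq_bigr => n _ do rewrite -E.
rewrite (big_ord_widen d (fun n => (extC (fpsC (n`!%:R)^-1) * G ^+ n) J m) lt_md).
rewrite [RHS](bigID (fun n : 'I_d => n < (mdeg m).+1)%N) /= [X in _ + X]big1 ?addr0 //.
by move=> n; rewrite -leqNgt => lt_mn; rewrite E ext_order_geX ?mulr0.
Qed.

Variable w0 : ext V R.
Hypothesis wedge_w0 : forall v, extX v * w0 = 0.
Hypothesis const_w0 : forall y, ext_map (fps_deriv y) w0 = 0.
Local Notation Psi := (contract (ext_exp G) w0).

Let Psi_trunc d : ext V R :=
  \sum_(n < d) extC (fpsC (n`!%:R)^-1) * contract (G ^+ n) w0.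

Let Psi_truncP d : ext_order_ge d (Psi - Psi_trunc d).
Proof.
have -> : Psi - Psi_trunc d =
    contract (ext_exp G - \sum_(n < d) extC (fpsC (n`!%:R)^-1) * G ^+ n) w0.
  rewrite contractBl contract_suml; congr (_ - _).
  by apply: eq_bigr => n _; rewrite contractCM.
exact/ext_order_ge_contractl/ext_exp_trunc.
Qed.

(** The factor n + 1 of extX_quadratic_exp turns 1 / (n + 1)! into 1 / n!. *)
Lemma extX_exp_quadratic v : extX v * Psi = contract (H v) Psi.
Proof.
apply: (ext_limit_eq (F := fun w => extX v * w) (F' := contract (H v))
  (T := Psi_trunc)); last 1 first.
- move=> d; rewrite /Psi_trunc mulr_sumr big_ord_recl [RHS]contract_sumr.
  rewrite expr0 contractC mul1r extC_mulAC wedge_w0 mulr0 add0r.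
  apply: eq_bigr => n _; rewrite /= extC_mulAC contractMC extX_quadratic_exp //.
  rewrite mulrnAr -mulrnAl -(raddfMn (@extC V R)) -(raddfMn (@fpsC (V + U)%type k)) /=.
  by rewrite -[_ *+ n.+1]mulr_natr inv_fact_succ.
- exact: mulrBr.
- exact: contract_additive.
- move=> d w w_ord; apply: ext_order_geMl => J.
  by apply: (order_geW (leqnSn d)); apply: w_ord.
- by move=> d w; apply: ext_order_ge_contractr.
- exact: Psi_truncP.
Qed.

Lemma exp_quadratic_const y :
    fps_deriv y C = 0 -> (forall a b, fps_deriv y (p a b) = 0) ->
  ext_map (fps_deriv y) Psi = 0.
Proof.
move=> dC dp; have dM := @fps_derivM _ k y.
apply: (ext_limit_eq (F := ext_map (fps_deriv y)) (F' := fun=> 0)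
  (T := Psi_trunc)); last 1 first.
- move=> d; rewrite /Psi_trunc (raddf_sum (@ext_map V R (fps_deriv y))).
  apply: big1 => n _ /=; rewrite (ext_mapM dM) ext_mapC /= fps_derivC raddf0.
  rewrite mul0r add0r (ext_map_contract dM) const_w0.
  have G0 : ext_map (fps_deriv y) G = 0.
    by rewrite (ext_map_quadratic _ _ dM) quadratic_eq0.
  suff -> : ext_map (fps_deriv y) (G ^+ n) = 0.
    by rewrite contract0l (raddf0 (contract (G ^+ n))) addr0 mulr0.
  elim: (nat_of_ord n) => [|{}n IHn].
    by rewrite expr0 ext_mapC /= (fps_derivC _ 1) raddf0.
  by rewrite exprS (ext_mapM dM) G0 IHn mul0r mulr0 addr0.
- exact: ext_map_additive.
- by move=> u w; rewrite subr0.
- by move=> d w; apply: ext_order_ge_deriv.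
- by move=> d w _ J m _; rewrite ffunE.
- exact: Psi_truncP.
Qed.

Hypothesis jacobi_casimir :
  \sum_v H v * quadratic (D v C) (fun a b => D v (p a b)) = 0.
Hypothesis divergence_free : forall u, \sum_v D v (p v u - p u v) = 0.

Lemma de_rham_exp_quadratic : de_rham (fun v => D v) Psi = 0.
Proof.
have dM (v : V) := @fps_derivM _ k (inl v : V + U).
apply: (ext_limit_eq (F := de_rham (fun v => D v)) (F' := fun=> 0)
  (T := Psi_trunc)); last 1 first.
- move=> d; rewrite /Psi_trunc (raddf_sum (de_rham (fun v => D v))).
  apply: big1 => n _ /=; rewrite (de_rhamCM dM) big1 => [|v _].
    rewrite (de_rham_quadratic_exp dM) ?mulr0 ?mul0r ?addr0 // => v.
    exact: const_w0.
  by rewrite /= fps_derivC raddf0 mul0r.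
- exact: de_rham_additive.
- by move=> u w; rewrite subr0.
- move=> d w w_ord; rewrite /de_rham; apply: ext_order_ge_sum => v _.
  exact/ext_order_geMl/ext_order_ge_deriv.
- by move=> d w _ J m _; rewrite ffunE.
- exact: Psi_truncP.
Qed.

End ExpQuadratic.

(** * Linear Poisson structure and cubic Casimir of an associative algebra *)
Lemma sum_rotate (M : nmodType) (I : finType) (F : I -> I -> I -> M) :
  \sum_a \sum_b \sum_c F a b c = \sum_b \sum_c \sum_a F a b c.
Proof. by rewrite exchange_big; apply: eq_bigr => b _; rewrite exchange_big. Qed.

Section AssociativeStructure.
Variables (V U : finType) (k : fieldType).
Local Notation R := (fps (V + U)%type k).
Local Notation D v := (fps_deriv (inl v : V + U)).
Local Notation x v := (fpsX (inl v : V + U) : R).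

(* s are the structure constants of an associative algebra L in a basis
   indexed by V, and t the components of a cyclic trilinear form on its dual,
   invariant under L in the sense of tS below. *)
Variables (s t : V -> V -> V -> k) (c0 : k).

Definition linear_product (a b : V) : R := \sum_c fpsC (s a b c) * x c.

Definition cubic_form : R :=
  fpsC c0 * \sum_a \sum_b \sum_c fpsC (t a b c) * (x a * x b * x c).

Local Notation p := (fun a b => - linear_product a b).

Lemma order_ge_linear_product a b : order_ge 1 (linear_product a b).
Proof.
by apply: order_ge_sum => c _; apply/order_geMl/order_ge_fpsX.
Qed.

Lemma order_ge_cubic_form : order_ge 1 cubic_form.
Proof.
apply: order_geMl; apply: order_ge_sum => a _; apply: order_ge_sum => b _.
by apply: order_ge_sum => c _; do 2!apply: order_geMl; apply: order_ge_fpsX.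
Qed.

Lemma deriv_linear_product v a b : D v (linear_product a b) = fpsC (s a b v).
Proof.
rewrite raddf_sum (bigD1 v) //= big1 => [|c /negPf ncv].
  by rewrite fps_derivM fps_derivC fps_derivX eqxx mul0r add0r mulr1 addr0.
rewrite fps_derivM fps_derivC fps_derivX (inj_eq inl_inj) eq_sym ncv.
by rewrite mul0r mulr0 addr0.
Qed.

Lemma deriv_inr_linear_product (y : U) a b :
  fps_deriv (inr y : V + U) (linear_product a b) = 0.
Proof.
rewrite raddf_sum big1 // => c _ /=.
by rewrite fps_derivM fps_derivC fps_derivX mul0r mulr0 addr0.
Qed.

Lemma deriv_inr_cubic_form (y : U) : fps_deriv (inr y : V + U) cubic_form = 0.
Proof.
rewrite fps_derivM fps_derivC mul0r add0r raddf_sum big1 ?mulr0 // => a _ /=.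
rewrite raddf_sum big1 // => b _; rewrite raddf_sum big1 // => c _ /=.
by rewrite !fps_derivM fps_derivC !fps_derivX !(mul0r, mulr0, addr0).
Qed.

Hypothesis tC : forall a b c, t a b c = t b c a.

Lemma deriv_cubic_form v : D v cubic_form =
  fpsC c0 * ((\sum_a \sum_b fpsC (t a b v) * (x a * x b)) *+ 3).
Proof.
rewrite fps_derivM fps_derivC mul0r add0r; congr (_ * _).
have DX a : D v (x a) = (a == v)%:R by rewrite fps_derivX (inj_eq inl_inj) eq_sym.
have pick (F : V -> R) : \sum_a F a * (a == v)%:R = F v.
  rewrite (bigD1 v) //= big1 ?addr0 ?eqxx ?mulr1 // => a /negPf->.
  exact: mulr0.
pose F a b := \sum_c fpsC (t a b c) * ((a == v)%:R * (x b * x c)).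
pose F' a b := \sum_c fpsC (t a b c) * ((b == v)%:R * (x a * x c)).
pose F'' a b := \sum_c fpsC (t a b c) * ((c == v)%:R * (x a * x b)).
transitivity (\sum_a \sum_b (F a b + F' a b + F'' a b)).
  rewrite raddf_sum; apply: eq_bigr => a _ /=.
  rewrite raddf_sum; apply: eq_bigr => b _ /=.
  rewrite raddf_sum -!big_split; apply: eq_bigr => c _ /=.
  rewrite !fps_derivM fps_derivC !DX; ring.
under eq_bigr => a _ do rewrite !big_split.
rewrite !big_split mulrS mulr2n addrA /=; congr (_ + _ + _).
- rewrite (bigD1 v) //= [X in _ + X]big1 ?addr0; last first.
    move=> a /negPf nav; apply: big1 => b _; apply: big1 => c _.
    by rewrite nav mul0r mulr0.
  apply: eq_bigr => b _; apply: eq_bigr => c _.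
  by rewrite eqxx mul1r tC.
- rewrite exchange_big (bigD1 v) //= [X in _ + X]big1 ?addr0; last first.
    move=> a /negPf nav; apply: big1 => b _; apply: big1 => c _.
    by rewrite nav mul0r mulr0.
  rewrite exchange_big /=; apply: eq_bigr => b _; apply: eq_bigr => c _.
  by rewrite eqxx mul1r -tC [x c * _]mulrC.
- apply: eq_bigr => a _; apply: eq_bigr => b _.
  rewrite -[RHS](pick (fun c => fpsC (t a b c) * (x a * x b))).
  apply: eq_bigr => c _; ring.
Qed.

Hypothesis tS : forall a b c z,
  \sum_y s y z b * t a y c = \sum_y s z y a * t y b c.

(** By cyclicity and tS, the left and right multiplications by the basis
   element u give the same result on the cubic form, up to the names of the
   three variables, in which the monomial is symmetric. *)
Lemma casimir_cubic_form u :
  \sum_v (p v u - p u v) * D v cubic_form = 0.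
Proof.
pose Q v := \sum_a \sum_b fpsC (t a b v) * (x a * x b).
suff Es : \sum_v linear_product v u * Q v = \sum_v linear_product u v * Q v.
  transitivity ((\sum_v (linear_product u v * Q v - linear_product v u * Q v))
                  * (fpsC c0 *+ 3)).
    rewrite mulr_suml; apply: eq_bigr => v _; rewrite deriv_cubic_form -/(Q v).
    ring.
  by rewrite sumrB Es subrr mul0r.
pose K a b c : R := fpsC (\sum_v s u v a * t b c v).
have E (F : V -> V -> k) : \sum_v (\sum_w fpsC (F v w) * x w) * Q v =
    \sum_w \sum_a \sum_b fpsC (\sum_v F v w * t a b v) * (x w * x a * x b).
  under eq_bigr => v _ do rewrite mulr_suml.
  rewrite exchange_big; apply: eq_bigr => w _ /=.
  under eq_bigr => v _ do rewrite mulr_sumr.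
  rewrite exchange_big; apply: eq_bigr => a _ /=.
  under eq_bigr => v _ do rewrite mulr_sumr.
  rewrite exchange_big; apply: eq_bigr => b _ /=.
  rewrite raddf_sum mulr_suml; apply: eq_bigr => v _ /=.
  rewrite rmorphM /=; ring.
rewrite (E (fun v w => s v u w)) (E (fun v w => s u v w)).
transitivity (\sum_w \sum_a \sum_b K b w a * (x w * x a * x b)).
  apply: eq_bigr => w _; apply: eq_bigr => a _; apply: eq_bigr => b _.
  congr (fpsC _ * _); rewrite (eq_bigr (fun v => s v u w * t b v a)) => [|v _].
    by rewrite tS; apply: eq_bigr => v _; rewrite tC.
  by rewrite -tC tC tC.
under eq_bigr => w _ do rewrite exchange_big.
rewrite exchange_big; apply: eq_bigr => b _; apply: eq_bigr => w _.
by apply: eq_bigr => a _; congr (_ * _); ring.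
Qed.

Hypothesis sA : forall a b c w,
  \sum_v s a b v * s v c w = \sum_v s b c v * s a v w.

(** After summation over v, the coefficient is K a b u - K u a b, where K gives
   the product of three basis elements of L by associativity; a cyclic
   permutation of three anticommuting generators is even, so the two terms
   cancel. *)
Lemma jacobi_linear_product :
  \sum_v hamiltonian p v * quadratic 0 (fun a b => D v (p a b)) = 0.
Proof.
pose K a b c := \sum_w fpsC (\sum_v s b c v * s a v w) * x w.
have KE u a b : \sum_v (p v u - p u v) * D v (p a b) = K a b u - K u a b.
  transitivity (\sum_v (linear_product v u * fpsC (s a b v)
                        - linear_product u v * fpsC (s a b v))).
    apply: eq_bigr => v _.
    by rewrite fps_derivN deriv_linear_product; ring.
  have E (F : V -> V -> k) :
      \sum_v (\sum_w fpsC (F v w) * x w) * fpsC (s a b v) =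
      \sum_w fpsC (\sum_v s a b v * F v w) * x w.
    under eq_bigr => v _ do rewrite mulr_suml.
    rewrite exchange_big; apply: eq_bigr => w _ /=.
    rewrite raddf_sum mulr_suml; apply: eq_bigr => v _ /=.
    rewrite rmorphM /=; ring.
  rewrite sumrB (E (fun v w => s v u w)) (E (fun v w => s u v w)).
  by congr (_ - _); apply: eq_bigr => w _; rewrite sA.
pose th (a b c : V) : ext V R := extX a * (extX b * extX c).
have thC a b c : th a b c = th b c a.
  rewrite /th mulrA (extX_anticomm _ a b) mulNr -mulrA.
  by rewrite (extX_anticomm _ a c) mulrN opprK.
transitivity (\sum_u \sum_a \sum_b extC (K a b u - K u a b) * th u a b).
  transitivity (\sum_v \sum_u \sum_a \sum_b
      extC ((p v u - p u v) * D v (p a b)) * th u a b).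
    apply: eq_bigr => v _; rewrite /quadratic raddf0 add0r mulr_suml.
    apply: eq_bigr => u _; rewrite mulr_sumr; apply: eq_bigr => a _.
    rewrite mulr_sumr; apply: eq_bigr => b _.
    rewrite rmorphM -mulrA [extX u * _]mulrA -extC_comm -!mulrA; congr (_ * _).
  rewrite exchange_big; apply: eq_bigr => u _ /=.
  rewrite exchange_big; apply: eq_bigr => a _ /=.
  rewrite exchange_big; apply: eq_bigr => b _ /=.
  by rewrite -mulr_suml -raddf_sum KE.
transitivity (\sum_u \sum_a \sum_b (extC (K a b u) * th a b u)
              - \sum_u \sum_a \sum_b (extC (K u a b) * th u a b)).
  rewrite -sumrB; apply: eq_bigr => u _; rewrite -sumrB; apply: eq_bigr => a _.
  rewrite -sumrB; apply: eq_bigr => b _.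
  by rewrite (rmorphB (@extC V R)) mulrBl -(thC u a b).
apply/eqP; rewrite subr_eq0; apply/eqP.
exact: (sum_rotate (fun u a b => extC (K a b u) * th a b u)).
Qed.

Lemma jacobi_casimir_linear_product :
  \sum_v hamiltonian p v * quadratic (D v cubic_form) (fun a b => D v (p a b)) = 0.
Proof.
have Q v : quadratic (D v cubic_form) (fun a b => D v (p a b)) =
    extC (D v cubic_form) + quadratic 0 (fun a b => D v (p a b)).
  by rewrite /quadratic raddf0 add0r.
under eq_bigr => v _ do rewrite Q mulrDr.
rewrite big_split /= jacobi_linear_product addr0 /hamiltonian.
under eq_bigr => v _ do rewrite mulr_suml.
rewrite exchange_big big1 // => u _.
under eq_bigr => v _ do rewrite -mulrA -extC_comm mulrA -rmorphM.
by rewrite -mulr_suml -raddf_sum casimir_cubic_form raddf0 mul0r.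
Qed.

Hypothesis s_unimodular : forall u, \sum_v s v u v = \sum_v s u v v.

Lemma divergence_linear_product u : \sum_v D v (p v u - p u v) = 0.
Proof.
under eq_bigr => v _ do
  rewrite raddfB !raddfN /= !deriv_linear_product opprK addrC -raddfB.
by rewrite -raddf_sum sumrB s_unimodular subrr raddf0.
Qed.

End AssociativeStructure.

(** * Dual bases *)
Lemma sum_triple (R : nmodType) (I J K : finType) (F : I * J * K -> R) :
  \sum_u F u = \sum_a \sum_i \sum_j F (a, i, j).
Proof. by rewrite pair_bigA pair_bigA; apply: eq_bigr => -[[a i] j] _. Qed.

Section DualBases.
Variables (k : fieldType) (A : oddAlgebra k) (r : nat).
Variables (e : r.-tuple (even_part A)) (xi : 'I_r -> odd_part A).
Hypothesis dual : dual_bases e xi.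
Local Notation "a ** b" := (amul a b) (at level 40, left associativity).
Local Notation "<< a , b >>" := (aform a b).
Local Notation eb b := (ev (tnth e b)).
Local Notation xb b := (od (xi b)).

Lemma aformBl (a a' b : even_part A * odd_part A) :
  << a - a', b >> = << a, b >> - << a', b >>.
Proof. by rewrite addrC -scaleN1r aform_linear mulN1r addrC. Qed.

Lemma aform_suml (I : finType) (c : I -> k) (F : I -> even_part A * odd_part A) b :
  << \sum_i c i *: F i, b >> = \sum_i c i * << F i, b >>.
Proof.
have a0 : << 0, b >> = 0.
  have := aform_linear b 1 0 0; rewrite scaler0 addr0 mul1r => /eqP.
  by rewrite -subr_eq0 opprD addrA subrr sub0r oppr_eq0 => /eqP.
by elim/big_rec2: _ => //= i y x _ <-; rewrite aform_linear.
Qed.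

Lemma homogeneous_od (a : even_part A * odd_part A) :
  homogeneous true a -> a = od a.2.
Proof. by case: a => a0 a1 /= ->. Qed.

Lemma homogeneous_ev (a : even_part A * odd_part A) :
  homogeneous false a -> a = ev a.1.
Proof. by case: a => a0 a1 /= ->. Qed.

Lemma od_sum (c : 'I_r -> k) :
  od (\sum_i c i *: xi i) = \sum_i c i *: xb i :> even_part A * odd_part A.
Proof.
elim/big_rec2: _ => // i x y _ <-.
by rewrite /od; congr (_, _); rewrite /= ?scaler0 ?addr0.
Qed.

Lemma ev_sum (I : finType) (c : I -> k) (F : I -> even_part A) :
  ev (\sum_i c i *: F i) = \sum_i c i *: ev (F i) :> even_part A * odd_part A.
Proof.
elim/big_rec2: _ => // i x y _ <-.
by rewrite /ev; congr (_, _); rewrite /= ?scaler0 ?addr0.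
Qed.

(** Resolution of the identity in the dual pair of bases. *)
Lemma aform_expand a x : homogeneous true x ->
  << a, x >> = \sum_i << a, xb i >> * << eb i, x >>.
Proof.
move=> /homogeneous_od->; have [c [-> _]] := dual_bases_odd dual x.2.
rewrite od_sum aform_sym aform_suml; apply: eq_bigr => i _.
rewrite aform_sym mulrC; congr (_ * _).
rewrite aform_sym aform_suml; under eq_bigr => j _ do
  rewrite aform_sym (dual_basesE dual) mulrC.
by rewrite sum_delta_sym.
Qed.

Lemma even_expand (x : even_part A) :
  x = \sum_i << ev x, xb i >> *: tnth e i.
Proof.
have /andP[/eqP span_e free_e] := dual_bases_even dual.
have x_e : x \in <<e>>%VS by rewrite span_e memvf.
rewrite {1}(coord_span x_e); apply: eq_bigr => i _.
rewrite -(tnth_nth 0); congr (_ *: _).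
rewrite {2}(coord_span x_e) ev_sum aform_suml.
under eq_bigr => j _ do rewrite -(tnth_nth 0) (dual_basesE dual) mulrC.
by rewrite sum_delta.
Qed.

Lemma even_mul (a b : even_part A) : homogeneous false (ev a ** ev b).
Proof. exact: (@amul_graded _ _ false false). Qed.

Lemma even_odd_mul (a : even_part A) (x : odd_part A) : homogeneous true (ev a ** od x).
Proof. exact: (@amul_graded _ _ false true). Qed.

Lemma odd_even_mul (x : odd_part A) (a : even_part A) : homogeneous true (od x ** ev a).
Proof. exact: (@amul_graded _ _ true false). Qed.

Lemma aform_cyclic (a b c : even_part A * odd_part A) :
  << a ** b, c >> = << b ** c, a >>.
Proof. by rewrite aform_invariant aform_sym. Qed.

Fact lie_ad_linear (a : even_part A) : linear (lie_ad a).
Proof.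
move=> c x y; rewrite /lie_ad.
have -> : ev (c *: x + y) = c *: ev x + ev y :> even_part A * odd_part A.
  by rewrite /ev; congr (_, _); rewrite /= scaler0 addr0.
rewrite amul_linearr amul_linearl /= scalerBr !linearD /=.
by rewrite addrACA.
Qed.
HB.instance Definition _ (a : even_part A) :=
  GRing.isLinear.Build k (even_part A) (even_part A) _ (lie_ad a) (lie_ad_linear a).

(** Expanding the vectors of the standard basis in e and then collecting the
   coordinates along the standard basis compares the two traces without a
   matrix of change of basis. *)
Lemma trace_dual_bases (f : {linear even_part A -> even_part A}) :
  \tr (passmx.mxof (vbasis {:even_part A}) (vbasis {:even_part A}) (linfun f)) =
  \sum_i << ev (f (tnth e i)), xb i >>.
Proof.
set B := vbasis _; have /andP[/eqP span_B free_B] : basis_of {:even_part A} B.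
  exact: vbasisP.
have -> : \tr (passmx.mxof B B (linfun f)) = \sum_i coord B i (f B`_i).
  apply: eq_bigr => i _; rewrite /passmx.mxof mxE /= /passmx.rVof mxE /=.
  by rewrite /passmx.vecof lfunE /=; congr (coord _ _ (f _));
   rewrite (bigD1 i) //= mxE !eqxx scale1r big1 ?addr0 // => j nji;
    rewrite mxE (negPf nji) scale0r.
have EB i : f B`_i = \sum_j << ev B`_i, xb j >> *: f (tnth e j).
  by rewrite {1}[B`_i]even_expand linear_sum; apply: eq_bigr => j _; rewrite linearZ.
under eq_bigr => i _ do rewrite EB linear_sum.
rewrite exchange_big; apply: eq_bigr => j _ /=.
have fB : f (tnth e j) \in <<B>>%VS by rewrite span_B memvf.
rewrite [in RHS](coord_span fB) ev_sum aform_suml.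
by apply: eq_bigr => i _; rewrite linearZ mulrC.
Qed.

End DualBases.

(** * The algebra of matrices over the even part *)
Section MatrixModel.
Variables (k : fieldType) (A : oddAlgebra k) (r N : nat).
Variables (e : r.-tuple (even_part A)) (xi : 'I_r -> odd_part A).
Hypothesis dual : dual_bases e xi.
Local Notation "a ** b" := (amul a b) (at level 40, left associativity).
Local Notation "<< a , b >>" := (aform a b).
Local Notation eb b := (ev (tnth e b)).
Local Notation xb b := (od (xi b)).
Local Notation idx := ('I_r * 'I_N * 'I_N)%type.
Local Notation fn := (fps (idx + idx)%type k).
Local Notation x v := (fpsX (inl v : idx + idx) : fn).
Local Notation y v := (fpsX (inr v : idx + idx) : fn).
Local Notation D v := (fps_deriv (inl v : idx + idx)).

(** For v = (a, i, j), T_v is e_a (x) E with E the elementary matrix in row j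
   and column i, so that x_v is the pairing with T_v; gl_structure u v w is the
   coordinate of T_u T_v along T_w. *)
Definition gl_structure (u v w : idx) : k :=
  << eb u.1.1 ** eb v.1.1, xb w.1.1 >> *
    ((u.1.2 == v.2)%:R * (w.2 == u.2)%:R * (w.1.2 == v.1.2)%:R).

(** The form <m1 m2, m3> on the vectors xi_a (x) E, with E the elementary matrix
   in row i and column j, which are dual to the T_v. *)
Definition gl_cubic (u v w : idx) : k :=
  << xb u.1.1 ** xb v.1.1, xb w.1.1 >> *
    ((u.2 == v.1.2)%:R * (v.2 == w.1.2)%:R * (w.2 == u.1.2)%:R).

Local Notation s := gl_structure.
Local Notation t := gl_cubic.
Local Notation p := (fun u v => - linear_product s u v : fn).

Lemma gl_cubicC u v w : t u v w = t v w u.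
Proof. by rewrite /t aform_cyclic; congr (_ * _); ring. Qed.

Lemma sum_idx_select (R : pzSemiRingType) (H : idx -> R) i0 j0 :
  \sum_v (v.1.2 == i0)%:R * ((v.2 == j0)%:R * H v) = \sum_a H (a, i0, j0).
Proof.
rewrite sum_triple; apply: eq_bigr => a _ /=.
under eq_bigr => i _ do rewrite -mulr_sumr sum_delta.
by rewrite sum_delta.
Qed.

Lemma sum_idx_delta (F : 'I_r -> k) (G : 'I_N -> 'I_N -> k) i0 j0 :
  \sum_(v : idx) F v.1.1 * ((v.1.2 == i0)%:R * ((v.2 == j0)%:R * G v.1.2 v.2)) =
  (\sum_a F a) * G i0 j0.
Proof.
rewrite mulr_suml -[RHS](sum_idx_select (fun v => F v.1.1 * G v.1.2 v.2)).
by apply: eq_bigr => v _; ring.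
Qed.

(** Resolving the identity reduces both sides to the form
   <<e_b e_c, xi_w e_a>>, up to matrix indices. *)
Lemma gl_structureA a b c w :
  \sum_v s a b v * s v c w = \sum_v s b c v * s a v w.
Proof.
pose F v := << eb a.1.1 ** eb b.1.1, xb v >> * << eb v ** eb c.1.1, xb w.1.1 >>.
pose F' v := << eb b.1.1 ** eb c.1.1, xb v >> * << eb a.1.1 ** eb v, xb w.1.1 >>.
pose G i j : k := (a.1.2 == b.2)%:R * (i == c.2)%:R * (w.2 == j)%:R * (w.1.2 == c.1.2)%:R.
pose G' i j : k := (b.1.2 == c.2)%:R * (a.1.2 == j)%:R * (w.2 == a.2)%:R * (w.1.2 == i)%:R.
transitivity ((\sum_v F v) * G b.1.2 a.2).
  rewrite -(sum_idx_delta F G); apply: eq_bigr => v _; rewrite /s /F /G; ring.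
transitivity ((\sum_v F' v) * G' c.1.2 b.2); last first.
  rewrite -(sum_idx_delta F' G'); apply: eq_bigr => v _; rewrite /s /F' /G'; ring.
congr (_ * _); last by rewrite /G /G'; ring.
have FE v : F v = << eb a.1.1 ** eb b.1.1, xb v >> * << eb v, eb c.1.1 ** xb w.1.1 >>.
  by rewrite -aform_invariant.
have FE' v : F' v = << eb b.1.1 ** eb c.1.1, xb v >> * << eb v, xb w.1.1 ** eb a.1.1 >>.
  by congr (_ * _); rewrite aform_cyclic aform_invariant.
rewrite (eq_bigr _ (fun v _ => FE v)) [RHS](eq_bigr _ (fun v _ => FE' v)).
rewrite -!(aform_expand dual); last 2 first.
- exact: odd_even_mul.
- exact: even_odd_mul.
by rewrite aform_cyclic amulA aform_invariant.
Qed.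

Lemma gl_cubicS a b c z :
  \sum_v s v z b * t a v c = \sum_v s z v a * t v b c.
Proof.
pose F v := << eb v ** eb z.1.1, xb b.1.1 >> * << xb a.1.1 ** xb v, xb c.1.1 >>.
pose F' v := << eb z.1.1 ** eb v, xb a.1.1 >> * << xb v ** xb b.1.1, xb c.1.1 >>.
pose G i j : k := (b.1.2 == z.1.2)%:R * (a.2 == i)%:R * (j == c.1.2)%:R * (c.2 == a.1.2)%:R.
pose G' i j : k := (a.2 == z.2)%:R * (j == b.1.2)%:R * (b.2 == c.1.2)%:R * (c.2 == i)%:R.
transitivity ((\sum_v F v) * G z.2 b.2).
  rewrite -(sum_idx_delta F G); apply: eq_bigr => v _; rewrite /s /t /F /G.
  rewrite [b.2 == v.2]eq_sym; ring.
transitivity ((\sum_v F' v) * G' a.1.2 z.1.2); last first.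
  rewrite -(sum_idx_delta F' G'); apply: eq_bigr => v _; rewrite /s /t /F' /G'.
  rewrite [z.1.2 == v.2]eq_sym [a.1.2 == v.1.2]eq_sym; ring.
congr (_ * _); last by rewrite /G /G' [z.1.2 == _]eq_sym; ring.
have FE v : F v = << xb c.1.1 ** xb a.1.1, xb v >> * << eb v, eb z.1.1 ** xb b.1.1 >>.
  rewrite /F mulrC; congr (_ * _); last exact: aform_invariant.
  exact: esym (aform_cyclic _ _ _).
have FE' v : F' v = << xb b.1.1 ** xb c.1.1, xb v >> * << eb v, xb a.1.1 ** eb z.1.1 >>.
  rewrite /F' mulrC; congr (_ * _); first exact: aform_cyclic.
  by rewrite aform_cyclic aform_invariant.
rewrite (eq_bigr _ (fun v _ => FE v)) [RHS](eq_bigr _ (fun v _ => FE' v)).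
rewrite -!(aform_expand dual); last 2 first.
- exact: odd_even_mul.
- exact: even_odd_mul.
by rewrite aform_cyclic amulA aform_invariant aform_sym.
Qed.

Lemma linear_product_glE u v : (linear_product s u v : fn) =
  (u.1.2 == v.2)%:R *
    \sum_a fpsC << eb u.1.1 ** eb v.1.1, xb a >> * x (a, v.1.2, u.2).
Proof.
rewrite mulr_sumr -[RHS](sum_idx_select (fun w => (u.1.2 == v.2)%:R *
  (fpsC << eb u.1.1 ** eb v.1.1, xb w.1.1 >> * x w))).
apply: eq_bigr => w _; rewrite /s !rmorphM /= !rmorph_nat; ring.
Qed.

Lemma bivector_glE :
  bivector N e xi = \sum_u \sum_v extC (p u v) * (extX u * extX v).
Proof.
pose T a b c i l j : ext idx fn :=
  extC (fpsC (mA false (xb a) (eb b) (eb c)) * x (a, i, j))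
    * (extX (b, l, j) * extX (c, i, l)).
transitivity (\sum_b \sum_l \sum_j \sum_c \sum_i \sum_a T a b c i l j).
  rewrite /bivector exchange_big; apply: eq_bigr => b _ /=.
  transitivity (\sum_a \sum_c \sum_i \sum_l \sum_j T a b c i l j).
    apply: eq_bigr => a _; apply: eq_bigr => c _.
    rewrite mulr_sumr; apply: eq_bigr => i _.
    rewrite mxE mulr_sumr; apply: eq_bigr => l _.
    rewrite mxE mulr_suml mulr_sumr; apply: eq_bigr => j _.
    by rewrite /T !mxE (rmorphM (@extC idx fn)) /= !mulrA.
  transitivity (\sum_l \sum_a \sum_c \sum_i \sum_j T a b c i l j).
    rewrite [RHS]exchange_big; apply: eq_bigr => a _ /=.
    rewrite [RHS]exchange_big; apply: eq_bigr => c _ /=.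
    exact: exchange_big.
  apply: eq_bigr => l _.
  transitivity (\sum_j \sum_a \sum_c \sum_i T a b c i l j).
    rewrite [RHS]exchange_big; apply: eq_bigr => a _ /=.
    rewrite [RHS]exchange_big; apply: eq_bigr => c _ /=.
    exact: exchange_big.
  apply: eq_bigr => j _.
  rewrite exchange_big; apply: eq_bigr => c _ /=.
  exact: exchange_big.
rewrite [RHS]sum_triple; apply: eq_bigr => b _; apply: eq_bigr => l _.
apply: eq_bigr => j _; rewrite [RHS]sum_triple; apply: eq_bigr => c _.
apply: eq_bigr => i _.
rewrite -[LHS](sum_delta_sym l (fun l' => \sum_a T a b c i l' j)).
apply: eq_bigr => l' _; rewrite linear_product_glE /=.
case: (eqVneq l l') => [<-|_]; last by rewrite !mul0r oppr0 raddf0 mul0r.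
rewrite !mul1r -sumrN raddf_sum mulr_suml; apply: eq_bigr => a _ /=.
by rewrite /T /mA expr1 mulN1r (rmorphN (@fpsC (idx + idx)%type k)) mulNr aform_cyclic.
Qed.

Lemma cubic_glE : cubic xi = cubic_form t (3`!%:R)^-1 :> fn.
Proof.
congr (_ * _).
have mE a b c : mA true (xb a) (xb b) (xb c) = << xb a ** xb b, xb c >>.
  by rewrite /mA /= sqrrN expr1n mul1r.
pose T a b c i l j : fn := fpsC << xb a ** xb b, xb c >>
    * (x (a, i, j) * x (b, j, l) * x (c, l, i)).
transitivity (\sum_a \sum_i \sum_j \sum_b \sum_l \sum_c T a b c i l j).
  apply: eq_bigr => a _.
  transitivity (\sum_b \sum_c \sum_i \sum_l \sum_j T a b c i l j).
    apply: eq_bigr => b _; apply: eq_bigr => c _.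
    rewrite mulr_sumr; apply: eq_bigr => i _.
    rewrite mxE mulr_sumr; apply: eq_bigr => l _.
    rewrite mxE mulr_suml mulr_sumr; apply: eq_bigr => j _.
    by rewrite /T !mxE mE.
  transitivity (\sum_i \sum_b \sum_c \sum_l \sum_j T a b c i l j).
    rewrite [RHS]exchange_big; apply: eq_bigr => b _ /=.
    exact: exchange_big.
  apply: eq_bigr => i _.
  transitivity (\sum_j \sum_b \sum_c \sum_l T a b c i l j).
    rewrite [RHS]exchange_big; apply: eq_bigr => b _ /=.
    rewrite [RHS]exchange_big; apply: eq_bigr => c _ /=.
    exact: exchange_big.
  apply: eq_bigr => j _; apply: eq_bigr => b _; exact: exchange_big.
rewrite [RHS]sum_triple; apply: eq_bigr => a _; apply: eq_bigr => i _.
apply: eq_bigr => j _; rewrite [RHS]sum_triple; apply: eq_bigr => b _ /=.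
rewrite -[LHS](sum_delta_sym j (fun j' => \sum_l \sum_c T a b c i l j')).
apply: eq_bigr => j' _; rewrite mulr_sumr; apply: eq_bigr => l _.
rewrite mulr_sumr -[LHS](sum_idx_select (fun w => (j == j')%:R *
   (fpsC << xb a ** xb b, xb w.1.1 >> * (x (a, i, j') * x (b, j', l) * x w)))).
apply: eq_bigr => w _; rewrite /t /= !rmorphM /= !rmorph_nat.
rewrite [l == _]eq_sym.
case: (eqVneq j j') => [<-|_]; rewrite ?mulr1n ?mulr0n; ring.
Qed.

Hypothesis unimodularA : unimodular A.

(** The traces of left and right multiplication by a (x) M on A_0 (x) gl_N are
   N tr M times those of a on A_0. *)
Lemma gl_structure_unimodular u : \sum_v s v u v = \sum_v s u v v.
Proof.
pose F a := << eb a ** eb u.1.1, xb a >>; pose F' a := << eb u.1.1 ** eb a, xb a >>.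
pose c : k := N%:R * (u.1.2 == u.2)%:R.
transitivity ((\sum_a F a) * c).
  rewrite sum_triple mulr_suml; apply: eq_bigr => a _.
  transitivity (\sum_(i < N) (i == u.2)%:R * ((i == u.1.2)%:R * (N%:R * F a))).
    apply: eq_bigr => i _; rewrite /s /=; under eq_bigr => j _ do rewrite eqxx mulr1n.
    by rewrite sumr_const card_ord -mulr_natr /F; ring.
  by rewrite sum_delta /c [u.2 == _]eq_sym; ring.
transitivity ((\sum_a F' a) * c); last first.
  rewrite sum_triple mulr_suml; apply: eq_bigr => a _.
  transitivity (\sum_(i < N) F' a * (u.1.2 == u.2)%:R).
    by rewrite sumr_const card_ord -mulr_natr /c; ring.
  apply: eq_bigr => i _; rewrite -[LHS](sum_delta_sym u.1.2 (fun j => F' a * (j == u.2)%:R)).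
  by apply: eq_bigr => j _; rewrite /s /= eqxx mulr1n /F'; ring.
congr (_ * _); apply/eqP; rewrite eq_sym -subr_eq0; apply/eqP.
rewrite -[RHS](unimodularA (tnth e u.1.1)) (trace_dual_bases dual) -sumrB.
apply: eq_bigr => a _; rewrite /F /F' /lie_ad.
set b := ev _; set b' := ev _.
have -> : ev (b ** b' - b' ** b).1 = b ** b' - b' ** b.
  rewrite [b ** b'](homogeneous_ev (even_mul _ _)).
  rewrite [b' ** b](homogeneous_ev (even_mul _ _)).
  by rewrite /ev /=; congr (_, _); rewrite /= subr0.
by rewrite aformBl.
Qed.

End MatrixModel.

Lemma mxtrace_lincomb (R : comNzRingType) n (a b : R) (P Q W : 'M[R]_n) :
  \tr ((a *: P - b *: Q) *m W) = a * \tr (P *m W) - b * \tr (Q *m W).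
Proof. by rewrite mulmxBl -!scalemxAl raddfB /= !mxtraceZ. Qed.

Lemma mxtrace_rotate_cancel (R : comNzRingType) n (a b : R) (P Q W : 'M[R]_n) :
  a * \tr (P *m Q *m W) - b * \tr (Q *m P *m W) +
    (b * \tr (P *m W *m Q) - a * \tr (W *m P *m Q)) = 0.
Proof.
have rot (X Y Z : 'M[R]_n) : \tr (X *m Y *m Z) = \tr (Y *m Z *m X).
  by rewrite -mulmxA mxtrace_mulC.
by rewrite (rot W P Q) (rot Q P W) addrA subrK subrr.
Qed.

(** * Co-adjoint fields and the pairing of Y with X *)
Section Equivariance.
Variables (k : fieldType) (A : oddAlgebra k) (r N : nat).
Variables (e : r.-tuple (even_part A)) (xi : 'I_r -> odd_part A).
Hypothesis dual : dual_bases e xi.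
Local Notation "a ** b" := (amul a b) (at level 40, left associativity).
Local Notation "<< a , b >>" := (aform a b).
Local Notation eb b := (ev (tnth e b)).
Local Notation xb b := (od (xi b)).
Local Notation idx := ('I_r * 'I_N * 'I_N)%type.
Local Notation fn := (fps (idx + idx)%type k).
Local Notation x v := (fpsX (inl v : idx + idx) : fn).
Local Notation y v := (fpsX (inr v : idx + idx) : fn).
Local Notation D v := (fps_deriv (inl v : idx + idx)).
Local Notation s := (gl_structure e xi).
Local Notation p := (fun u v => - linear_product s u v : fn).
Local Notation f := (trYX N e xi).

(** The coordinate of a (x) M along T_v. *)
Definition gl_coord (a : even_part A) (M : 'M[k]_N) (v : idx) : k :=
  << ev a, xb v.1.1 >> * M v.2 v.1.2.

(** The left side is x_u([a (x) M, X]) for u = (c, i, j), which by invariance of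
   the form is x([T_u, a (x) M]). *)
Lemma coadE (a : even_part A) (M : 'M[k]_N) c i j : coad e xi a M c i j =
  \sum_v fpsC (gl_coord a M v) * (p v (c, i, j) - p (c, i, j) v).
Proof.
pose L b : fn := fpsC << ev a ** xb b, eb c >> * \sum_l fpsC (M i l) * x (b, l, j).
pose L' b : fn := fpsC << xb b ** ev a, eb c >> * \sum_l x (b, i, l) * fpsC (M l j).
transitivity (\sum_b L b - \sum_b L' b).
  rewrite summxE -sumrB; apply: eq_bigr => b _; rewrite !mxE /L /L'.
  by congr (_ * _ - _ * _); apply: eq_bigr => l _; rewrite !mxE.
transitivity (\sum_v fpsC (gl_coord a M v) * linear_product s (c, i, j) v
            - \sum_v fpsC (gl_coord a M v) * (linear_product s v (c, i, j) : fn));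
  last by rewrite -sumrB; apply: eq_bigr => v _; ring.
congr (_ - _).
- transitivity (\sum_b \sum_l fpsC (gl_coord a M (b, l, i)) *
     \sum_d fpsC << eb c ** eb b, xb d >> * x (d, l, j)).
    transitivity (\sum_d \sum_l \sum_b fpsC (<< ev a, xb b >> * << eb b, xb d ** eb c >>)
       * (fpsC (M i l) * x (d, l, j))).
      apply: eq_bigr => d _; rewrite /L mulr_sumr; apply: eq_bigr => l _.
      rewrite -mulr_suml -(raddf_sum (@fpsC _ k)) -(aform_expand dual);
        last exact: odd_even_mul.
      by rewrite -aform_invariant.
    rewrite exchange_big [RHS]exchange_big; apply: eq_bigr => l _ /=.
    rewrite exchange_big; apply: eq_bigr => b _ /=.
    rewrite mulr_sumr; apply: eq_bigr => d _.
    rewrite [<< eb c ** _, _ >>]aform_cyclic aform_invariant /gl_coord.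
    by rewrite !(rmorphM (@fpsC _ k)) /=; ring.
  rewrite [RHS]sum_triple; apply: eq_bigr => b _.
  rewrite -[LHS](sum_delta_sym i (fun m => \sum_l fpsC (gl_coord a M (b, l, m)) *
     \sum_d fpsC << eb c ** eb b, xb d >> * x (d, l, j))).
  rewrite [RHS]exchange_big; apply: eq_bigr => m _ /=.
  rewrite mulr_sumr; apply: eq_bigr => l _.
  rewrite linear_product_glE /=; ring.
- transitivity (\sum_b \sum_m fpsC (gl_coord a M (b, j, m)) *
     \sum_d fpsC << eb b ** eb c, xb d >> * x (d, i, m)).
    transitivity (\sum_d \sum_m \sum_b fpsC (<< ev a, xb b >> * << eb b, eb c ** xb d >>)
       * (fpsC (M m j) * x (d, i, m))).
      apply: eq_bigr => d _; rewrite /L' mulr_sumr; apply: eq_bigr => m _.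
      rewrite -mulr_suml -(raddf_sum (@fpsC _ k)) -(aform_expand dual);
        last exact: even_odd_mul.
      by rewrite -aform_invariant [<< _ ** ev a, _ >>]aform_cyclic; ring.
    rewrite exchange_big [RHS]exchange_big; apply: eq_bigr => m _ /=.
    rewrite exchange_big; apply: eq_bigr => b _ /=.
    rewrite mulr_sumr; apply: eq_bigr => d _.
    rewrite -aform_invariant /gl_coord.
    by rewrite !(rmorphM (@fpsC _ k)) /=; ring.
  rewrite [RHS]sum_triple; apply: eq_bigr => b _.
  rewrite -[LHS](sum_delta j (fun l => \sum_m fpsC (gl_coord a M (b, l, m)) *
     \sum_d fpsC << eb b ** eb c, xb d >> * x (d, i, m))).
  apply: eq_bigr => l _; rewrite mulr_sumr; apply: eq_bigr => m _.
  rewrite linear_product_glE /=; ring.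
Qed.

Lemma coad_fieldE a M : coad_field e xi a M =
  \sum_v extC (fpsC (gl_coord a M v)) * hamiltonian p v.
Proof.
rewrite /hamiltonian; under [RHS]eq_bigr => v _ do rewrite mulr_sumr.
rewrite exchange_big sum_triple; apply: eq_bigr => c _; apply: eq_bigr => i _.
apply: eq_bigr => j _ /=; rewrite coadE (raddf_sum (@extC idx fn)) mulr_suml.
by apply: eq_bigr => v _; rewrite /= (rmorphM (@extC idx fn)) /= mulrA.
Qed.

Lemma coad_field_basis b l j :
  coad_field e xi (tnth e b) (delta_mx j l) = hamiltonian p (b, l, j).
Proof.
rewrite coad_fieldE (bigD1 (b, l, j)) //= big1 => [|[[b' l'] j'] nv].
  rewrite /gl_coord /= (dual_basesE dual) mxE !eqxx mulr1.
  by rewrite (rmorph1 (@fpsC _ k)) (rmorph1 (@extC _ fn)) mul1r addr0.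
rewrite /gl_coord /= (dual_basesE dual) mxE -natrM mulnb.
suff -> : (b == b') && ((j' == j) && (l' == l)) = false.
  by rewrite (raddf0 (@fpsC _ k)) (raddf0 (@extC _ fn)) mul0r.
apply: contraNF nv => /and3P[/eqP-> /eqP-> /eqP->].
exact: eqxx.
Qed.

Lemma trYX_E : f = \sum_(v : idx) x v * y (v.1.1, v.2, v.1.2).
Proof.
rewrite sum_triple /trYX; apply: eq_bigr => a _.
rewrite (bigD1 a) //= [X in _ + X]big1 ?addr0 => [|b /negPf nba]; last first.
  by rewrite (dual_basesE dual) eq_sym nba (raddf0 (@fpsC _ k)) mul0r.
rewrite (dual_basesE dual) eqxx (rmorph1 (@fpsC _ k)) mul1r.
rewrite exchange_big; apply: eq_bigr => i _; rewrite mxE.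
by apply: eq_bigr => j _; rewrite !mxE mulrC.
Qed.

Lemma deriv_inl_trYX v : D v f = y (v.1.1, v.2, v.1.2).
Proof.
rewrite trYX_E (raddf_sum (@fps_deriv _ k _)).
rewrite -[RHS](sum_delta_sym v (fun u => y (u.1.1, u.2, u.1.2))).
apply: eq_bigr => u _; rewrite /= fps_derivM !fps_derivX (inj_eq inl_inj).
by rewrite mulr0 addr0.
Qed.

Lemma deriv_inr_trYX v : fps_deriv (inr v : idx + idx) f = x (v.1.1, v.2, v.1.2).
Proof.
rewrite trYX_E (raddf_sum (@fps_deriv _ k _)) (bigD1 (v.1.1, v.2, v.1.2)) //=.
rewrite big1 => [|[[b l] j] nu].
  case: v => [[b l] j] /=; rewrite fps_derivM !fps_derivX eqxx mul0r add0r mulr1.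
  exact: addr0.
case: v nu => [[b' l'] j'] /= nu; rewrite fps_derivM !fps_derivX mul0r add0r.
by rewrite (inj_eq inr_inj);
case: (eqVneq (b', l', j') (b, j, l)) nu => [[-> -> ->]|_ _];
  rewrite ?eqxx ?mulr0n ?mulr0.
Qed.

(** The function Tr <Y, X> is invariant under simultaneous adjoint and
   co-adjoint action: after exchanging the two basis indices in the second
   half, the terms cancel by invariance of the form and of the trace. *)
Lemma trYX_invariant (a : even_part A) (M : 'M[k]_N) :
  \sum_(v : idx) coad e xi a M v.1.1 v.1.2 v.2 * D v f + ad_deriv e xi a M f = 0.
Proof.
pose Mf : 'M[fn]_N := cst_mx r M.
have trE (F G : 'I_r -> 'I_r -> fn) (Z W : 'I_r -> 'M[fn]_N) :
    \sum_c \sum_i \sum_j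
      (\sum_b (F b c *: (Mf *m Z b) - G b c *: (Z b *m Mf))) i j * W c j i =
    \sum_c \sum_b (F b c * \tr (Mf *m Z b *m W c) - G b c * \tr (Z b *m Mf *m W c)).
  apply: eq_bigr => c _.
  transitivity (\tr ((\sum_b (F b c *: (Mf *m Z b) - G b c *: (Z b *m Mf))) *m W c)).
    by apply: eq_bigr => i _; rewrite mxE.
  rewrite mulmx_suml (raddf_sum (@mxtrace _ N)); apply: eq_bigr => b _ /=.
  exact: mxtrace_lincomb.
rewrite sum_triple /ad_deriv.
transitivity ((\sum_c \sum_i \sum_j coad e xi a M c i j * mY k N c j i)
   + \sum_c \sum_i \sum_j ad e xi a M c i j * mX k N c j i).
  congr (_ + _); apply: eq_bigr => c _; apply: eq_bigr => i _; apply: eq_bigr => j _.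
    by rewrite deriv_inl_trYX mxE.
  by rewrite deriv_inr_trYX mxE.
rewrite [X in X + _](trE (fun b c => fpsC << ev a ** xb b, eb c >>)
  (fun b c => fpsC << xb b ** ev a, eb c >>) (mX k N) (mY k N)).
rewrite [X in _ + X](trE (fun b c => fpsC << ev a ** eb b, xb c >>)
  (fun b c => fpsC << eb b ** ev a, xb c >>) (mY k N) (mX k N)).
rewrite [X in _ + X]exchange_big -big_split big1 // => c _ /=.
rewrite -big_split big1 // => b _ /=.
have -> : << eb c ** ev a, xb b >> = << ev a ** xb b, eb c >> by rewrite aform_cyclic.
have -> : << ev a ** eb c, xb b >> = << xb b ** ev a, eb c >> by rewrite [RHS]aform_cyclic.
exact: mxtrace_rotate_cancel.
Qed.

End Equivariance.

(** * The form Psi and its equivariant extension *)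
Section PsiForm.
Variables (k : fieldType) (A : oddAlgebra k) (r N : nat).
Variables (e : r.-tuple (even_part A)) (xi : 'I_r -> odd_part A) (lambda : k).
Hypothesis char0 : [pchar k] =i pred0.
Hypothesis dual : dual_bases e xi.
Local Notation idx := ('I_r * 'I_N * 'I_N)%type.
Local Notation fn := (fps (idx + idx)%type k).
Local Notation form := (ext idx fn).
Local Notation D v := (fps_deriv (inl v : idx + idx)).
Local Notation s := (gl_structure e xi).
Local Notation p := (fun u v => - linear_product s u v : fn).
Local Notation H v := (hamiltonian p v).
Local Notation f := (trYX N e xi).
Local Notation Psi := (Psi N e xi lambda).

Let C : fn := cubic_form (gl_cubic xi) (3`!%:R)^-1.
Let w0 : form := extC (fpsC lambda) * ext_top.

Let PsiE : Psi = contract (ext_exp (quadratic C p)) w0.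
Proof.
by rewrite /Defs.Psi cubic_glE bivector_glE.
Qed.

Let order_p (u v : idx) : order_ge 1 (p u v).
Proof. exact/order_geN/order_ge_linear_product. Qed.

Let extX_w0 v : extX v * w0 = 0.
Proof. by rewrite /w0 mulrA -extC_comm -mulrA extX_top mulr0. Qed.

Let deriv_w0 z : ext_map (fps_deriv z) w0 = 0.
Proof.
rewrite /w0 (ext_mapM (fps_derivM z)) (ext_map_top _ (fps_derivM z)) mulr0.
by rewrite ext_mapC /= fps_derivC raddf0 mul0r addr0.
Qed.

Lemma extX_Psi v : extX v * Psi = contract (H v) Psi.
Proof.
rewrite PsiE; apply: (extX_exp_quadratic char0 _ order_p extX_w0).
exact: order_ge_cubic_form.
Qed.

Lemma deriv_inr_Psi (u : idx) : ext_map (fps_deriv (inr u : idx + idx)) Psi = 0.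
Proof.
rewrite PsiE; apply: (exp_quadratic_const _ order_p deriv_w0).
- exact: order_ge_cubic_form.
- exact: deriv_inr_cubic_form.
by move=> a b; rewrite fps_derivN deriv_inr_linear_product oppr0.
Qed.

Lemma dDR_Psi : unimodular A -> dDR Psi = 0.
Proof.
move=> unimodularA; rewrite PsiE.
apply: (@de_rham_exp_quadratic idx idx k C p _ order_p w0 extX_w0 deriv_w0).
- exact: order_ge_cubic_form.
- apply: jacobi_casimir_linear_product.
  + exact: gl_cubicC.
  + exact: gl_cubicS.
  + exact: gl_structureA.
- by apply: divergence_linear_product => u; apply: gl_structure_unimodular.
Qed.

End PsiForm.

Section EquivariantExtension.
Variables (k : fieldType) (A : oddAlgebra k) (r N : nat).
Variables (e : r.-tuple (even_part A)) (xi : 'I_r -> odd_part A).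
Hypothesis char0 : [pchar k] =i pred0.
Hypothesis dual : dual_bases e xi.
Local Notation idx := ('I_r * 'I_N * 'I_N)%type.
Local Notation fn := (fps (idx + idx)%type k).
Local Notation form := (ext idx fn).
Local Notation D v := (fps_deriv (inl v : idx + idx)).
Local Notation s := (gl_structure e xi).
Local Notation p := (fun u v => - linear_product s u v : fn).
Local Notation H v := (hamiltonian p v).
Local Notation f := (trYX N e xi).

Lemma dDR_de_rham (w : form) : dDR w = de_rham (fun v : idx => D v) w.
Proof. by []. Qed.

Variable Psi : form.
Hypothesis extX_Psi : forall v, extX v * Psi = contract (H v) Psi.
Hypothesis deriv_inr_Psi :
  forall u : idx, ext_map (fps_deriv (inr u : idx + idx)) Psi = 0.
Hypothesis dPsi : dDR Psi = 0.

Let order_trYX : order_ge 1 f.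
Proof.
rewrite (trYX_E N dual); apply: order_ge_sum => v _.
exact/order_geMr/order_ge_fpsX.
Qed.

Local Notation ef := (fps_exp f).
(* The differential of f. *)
Let zeta : form := \sum_v extC (D v f) * extX v.

Let dDR_exp w : dDR (extC ef * w) = extC ef * (zeta * w + dDR w).
Proof.
rewrite !dDR_de_rham (de_rhamCM (fun v => fps_derivM (inl v : idx + idx))).
have -> : \sum_v extC (D v ef) * extX v = extC ef * zeta :> form.
  rewrite /zeta mulr_sumr; apply: eq_bigr => v _.
  by rewrite (fps_deriv_exp char0 order_trYX) (mulrC _ ef) (rmorphM (@extC idx fn)) mulrA.
by rewrite mulrDr mulrA.
Qed.

Lemma d_equivariant_exp_Psi : d_equivariant e xi (extC ef * Psi) = 0.
Proof.
rewrite /d_equivariant dDR_exp dPsi addr0.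
apply/eqP; rewrite subr_eq0; apply/eqP.
transitivity (\sum_v extC (D v f) * contract (H v) (extC ef * Psi)).
  rewrite /zeta mulr_suml mulr_sumr; apply: eq_bigr => v _.
  by rewrite contractMC -extX_Psi -mulrA extC_mulCA.
rewrite sum_triple; apply: eq_bigr => b _; apply: eq_bigr => l _.
apply: eq_bigr => j _; rewrite (deriv_inl_trYX dual) (coad_field_basis dual).
by rewrite [mY k N b j l]mxE.
Qed.

(** Contraction with the co-adjoint field is exterior product by a constant
   1-form eta, so that the Lie derivative of Psi vanishes and only the
   derivative of the exponential remains. *)
Lemma equivariant_exp_Psi : equivariant_form e xi (extC ef * Psi).
Proof.
move=> a M; set X := coad_field e xi a M.
pose c (v : idx) := coad e xi a M v.1.1 v.1.2 v.2.
pose eta : form := \sum_v extC (fpsC (gl_coord xi a M v)) * extX v.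
have XE : X = \sum_u extC (c u) * extX u by rewrite sum_triple.
have X_Psi : contract X Psi = eta * Psi.
  rewrite /X (coad_fieldE dual) contract_suml /eta mulr_suml.
  by apply: eq_bigr => v _; rewrite contractCM -extX_Psi mulrA.
have d_eta_Psi : dDR (eta * Psi) = 0.
  have cst (u v : idx) : D u (fpsC (gl_coord xi a M v)) = 0 by exact: fps_derivC.
  rewrite dDR_de_rham.
  rewrite (de_rham_constM (fun v => fps_derivM (inl v : idx + idx)) Psi cst).
  by rewrite -dDR_de_rham dPsi mulr0 oppr0.
have invariant_f : \sum_u c u * D u f + ad_deriv e xi a M f = 0.
  exact: trYX_invariant.
clearbody X c eta.
have X_zeta : contract X (zeta * Psi) =
    extC (\sum_u c u * D u f) * Psi - zeta * (eta * Psi).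
  rewrite -X_Psi /zeta !mulr_suml (raddf_sum (contract X)).
  rewrite (raddf_sum (@extC idx fn)) mulr_suml -sumrB; apply: eq_bigr => v _ /=.
  rewrite -mulrA contractMC XE contract_vector_extX mulrBr !mulrA.
  by rewrite -(rmorphM (@extC idx fn)) [D v f * _]mulrC.
have ad_Phi : ext_map (ad_deriv e xi a M) (extC ef * Psi) =
    extC ef * (extC (ad_deriv e xi a M f) * Psi).
  apply/ffunP => J; rewrite ffunE !extCM.
  have dJ u : fps_deriv (inr u : idx + idx) (Psi J) = 0.
    by have /ffunP/(_ J) := deriv_inr_Psi u; rewrite !ffunE.
  rewrite /ad_deriv !mulr_suml mulr_sumr; apply: eq_bigr => b _.
  rewrite !mulr_suml mulr_sumr; apply: eq_bigr => i _.
  rewrite !mulr_suml mulr_sumr; apply: eq_bigr => j _.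
  rewrite fps_derivM dJ mulr0 addr0 fps_deriv_exp //.
  by rewrite (mulrC _ ef) -!mulrA mulrCA.
rewrite /lie_derivative (contractMC X ef Psi) X_Psi !dDR_exp d_eta_Psi dPsi.
rewrite !addr0 (contractMC X ef (zeta * Psi)) X_zeta ad_Phi -!mulrDr addrCA addrN addr0 -mulrDl.
by rewrite -(rmorphD (@extC idx fn)) invariant_f raddf0 mul0r mulr0.
Qed.

End EquivariantExtension.

Theorem theorem1 (k : fieldType) (char0 : [pchar k] =i pred0)
    (A : oddAlgebra k) (r : nat) (dimA0 : \dim {:even_part A} = r)
    (unimodularA0 : unimodular A)
    (e : r.-tuple (even_part A)) (xi : 'I_r -> odd_part A)
    (dual : dual_bases e xi)
    (N : nat) (N_gt0 : (0 < N)%N) (lambda : k) :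
  let Phi := extC (fps_exp (trYX N e xi)) * Psi N e xi lambda in
  [/\ dDR (Psi N e xi lambda) = 0,
      equivariant_form e xi Phi
    & d_equivariant e xi Phi = 0].
Proof.
have dPsi := dDR_Psi N lambda dual unimodularA0.
have wedgePsi := @extX_Psi k A r N e xi lambda char0.
split=> //.
- exact: (equivariant_exp_Psi char0 dual wedgePsi (deriv_inr_Psi e xi lambda) dPsi).
- exact: (d_equivariant_exp_Psi char0 dual wedgePsi dPsi).
Qed.
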